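(* Let $X$ be a real random variable with distribution function $F$ and tail quantile function $U$. Assume that $U\in 2\mathrm{RV}_{\gamma,\rho}$ with $0<\gamma<1/2$, $\rho\le0$ and auxiliary function $A(t)$. Then, as $\tau\uparrow1$, $$dev_\tau(X)=\beta_\gamma q_\tau\,(1+w(\tau)),\qquad \beta_{\gamma}=\frac{(\gamma^{-1}-1)^{-\gamma}}{\sqrt{1-2\gamma}},$$ where $$w(\tau)=\xi_1\,q_\tau^{-1}(1+o(1))+\xi_2\,A\big((1-\tau)^{-1}\big)(1+o(1)),$$ $$\xi_1=(2\gamma-1)(\gamma^{-1}-1)^{\gamma}E(X),\qquad \xi_2=\frac{(\gamma^{-1}-1)^{-\rho}(2-3\gamma-\rho)}{(1-\rho-2\gamma)(1-\rho-\gamma)}+\frac{(\gamma^{-1}-1)^{-\rho}-1}{\rho}.$$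
   Context: For $\tau\in(0,1)$, $q_\tau=q_\tau(X)=\inf\{x\in\mathbb{R}:F(x)\ge\tau\}$ is the quantile. Write $x_+=\max\{x,0\}$, $x_-=-\min\{x,0\}$. The expectile of $X$ at level $\tau$ is $e_\tau=e_\tau(X)=\arg\min_{x\in\mathbb{R}}E[\tau(X-x)_+^2+(1-\tau)(X-x)_-^2]$. The adjusted standard-deviatile (deviatile) is $$dev_\tau(X)=\Big(\tfrac{\tau}{1-\tau}E[(X-e_\tau)_+^2]+E[(X-e_\tau)_-^2]\Big)^{1/2}.$$ The tail quantile function is $U(t)=F^{\leftarrow}(1-1/t)$, where $F^{\leftarrow}$ is the left-continuous inverse of $F$, so $q_\tau=U(1/(1-\tau))$. A measurable, eventually positive function $f$ is in $2\mathrm{RV}_{\gamma,\rho}$ ($\gamma\in\mathbb{R}$, $\rho\le0$) with auxiliary function $A$ if $A$ is ultimately positive or ultimately negative, $A(t)\to0$ as $t\to\infty$, and $$\lim_{t\to\infty}\frac{f(tx)/f(t)-x^\gamma}{A(t)}=x^\gamma\int_1^x u^{\rho-1}\,du,\qquad x>0,$$ where the integral is $\log x$ when $\rho=0$. Correspondingly, $\frac{(\gamma^{-1}-1)^{-\rho}-1}{\rho}$ is read as $-\log(\gamma^{-1}-1)$ when $\rho=0$.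
   Formalization: If ξ₁ or ξ₂ is zero (e.g. E(X)=0), its factor ξᵢ(1+o(1)) is read as o(1), since the literal zero term makes the claim false; E[X_-²] is also assumed finite so that e_τ and dev_τ are defined. *)

(* Defs.v *)
From HB Require Import structures.
From mathcomp Require Export all_boot all_order all_algebra.
From mathcomp Require Export all_classical all_reals all_analysis.

Set Implicit Arguments.
Unset Strict Implicit.
Unset Printing Implicit Defensive.

Export Order.TTheory GRing.Theory Num.Theory.
Export numFieldNormedType.Exports.

Local Open Scope classical_set_scope.
Local Open Scope ring_scope.

(* The library integral over `[a, b]` vanishes when b < a. *)
Definition oriented_integral (R : realType) (a b : R) (f : R -> R) : R :=
  if a <= b then \int[lebesgue_measure]_(u in `[a, b]) f u
  else - \int[lebesgue_measure]_(u in `[b, a]) f u.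

Definition second_order_RV (R : realType) (gamma rho : R) (A f : R -> R) :
    Prop :=
  [/\ measurable_fun (`]0, +oo[ : set R) f /\ (\forall t \near +oo, 0 < f t),
      (\forall t \near +oo, 0 < A t) \/ (\forall t \near +oo, A t < 0),
      A t @[t --> +oo] --> 0
    & forall x : R, 0 < x ->
        (f (t * x) / f t - x `^ gamma) / A t @[t --> +oo] -->
          x `^ gamma * oriented_integral 1 x (fun u => u `^ (rho - 1))].

Section RandomVariable.
Context d (T : measurableType d) (R : realType) (P : probability T R).
Variable X : {RV P >-> R}.

(* This is the generalized inverse of F only for 0 < p < 1; otherwise the
   set below may be unbounded below or empty and inf returns 0. *)
Definition quantile (p : R) : R := inf [set x : R | (p%:E <= cdf X x)%E].

(* Only t > 1 is meaningful. *)
Definition tail_quantile (t : R) : R := quantile (1 - t^-1).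

Definition expectile_loss (tau x : R) : \bar R :=
  ('E_P[(fun w => tau * ((X \- cst x)^\+ w) ^+ 2 +
                  (1 - tau) * ((X \- cst x)^\- w) ^+ 2)%R])%E.

(* For 0 < tau < 1 the loss is strictly convex and coercive as soon as it is
   finite, so that the minimizer exists and is unique; 0 is the default value
   of the choice operator when there is no minimizer. *)
Definition expectile (tau : R) : R :=
  xget 0 [set e | forall x, (expectile_loss tau e <= expectile_loss tau x)%E].

Definition deviatile (tau : R) : R :=
  let e := expectile tau in
  Num.sqrt (fine
    ((tau / (1 - tau))%:E * 'E_P[(fun w => ((X \- cst e)^\+ w) ^+ 2)%R]
     + 'E_P[(fun w => ((X \- cst e)^\- w) ^+ 2)%R])%E).

Definition xi1 (gamma : R) : R :=
  (2 * gamma - 1) * (gamma^-1 - 1) `^ gamma * fine ('E_P[X])%E.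

End RandomVariable.

Definition beta_coef (R : realType) (gamma : R) : R :=
  (gamma^-1 - 1) `^ (- gamma) / Num.sqrt (1 - 2 * gamma).

Definition xi2 (R : realType) (gamma rho : R) : R :=
  (gamma^-1 - 1) `^ (- rho) * (2 - 3 * gamma - rho) /
    ((1 - rho - 2 * gamma) * (1 - rho - gamma))
  + (if rho == 0 then - ln (gamma^-1 - 1)
     else ((gamma^-1 - 1) `^ (- rho) - 1) / rho).

(* The coefficient c(1 + o(1)), with e in the role of the o(1). In an
   asymptotic expansion a vanishing coefficient c stands for o(1), not for the
   constant 0. *)
Definition coef_1o (R : realType) (c e : R) : R :=
  if c == 0 then e else c * (1 + e).

(* Main.v *)
(* Up to the factor 1 - tau, the squared deviatile is the minimum of the expectile
   loss: it equals min V, where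
     V(x) = k E[(X - x)_+^2] + E[(X - x)^2],   k = (2 tau - 1) / (1 - tau).
   Since V(x) - x^2 is convex, V(x0) - V'(x0)^2 / 4 <= min V <= V(x0) for every
   x0.  For x0 = c q_tau with c = (1 / gamma - 1)^(- gamma), the first order
   equivalent of the expectile, V'(x0) / q_tau is O(1 / q_tau + |A|), so that the
   lower and upper bounds differ, relatively to q_tau^2, by o(1 / q_tau + |A|);
   hence it suffices to expand V(x0), and no second order expansion of the
   expectile is needed.

   With t = 1 / (1 - tau), the quantile transform gives
     E[(X - c U(t))_+^p] = (U(t)^p / t) int_0^t (U(t / z) / U(t) - c)_+^p dz,
   whose expansion in A(t) follows from the second order condition by dominated
   convergence.  The dominating function comes from a Potter type bound
     |U(t x) / U(t) - x^gamma| <= M x^theta |A(t)|,   gamma < theta < 1 / 2,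
   which extends by doubling x a locally uniform bound, itself obtained from the
   pointwise limits by Steinhaus' argument on sets of large measure. *)
Require Import Defs.
From mathcomp Require Import measurable_realfun.
From mathcomp Require Import ring lra.

Set Implicit Arguments.
Unset Strict Implicit.
Unset Printing Implicit Defensive.

Local Open Scope classical_set_scope.
Local Open Scope ring_scope.

(** * Rescaling sets of reals *)

(** The constant c solves int (z^(-gamma) - c)_+ dz = c, which is exactly what cancels the leading
    term of V'(x0) / q_tau. As the gap between the two bounds of min V is quadratic in that slope, a
    mere O-bound on the first tail moment suffices, and only the second moment needs a true
    expansion. The relative order of 1 / q_tau and A is unknown, so all errors are measured against
    the sum 1 / q_tau + |A|. The final remainder is shared between the two terms by means of the
    sign of A. The quantile transform integrates over z in ]0, t[, where t / z gets close to 1 and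
    no asymptotics of U is available. The positive part removes this range: its limit is supported
    in ]0, b] with b = 1 / gamma - 1, and by monotonicity of U the integrand vanishes beyond 2 b
    once t is large. Every integral therefore lives on the fixed interval ]0, 2 b]. *)

Section lebesgue_scaling.
Context {R : realType}.
Notation mu := (@lebesgue_measure R).

Let scale (l : R) : measurableTypeR R -> measurableTypeR R := fun x => l * x.

Let measurable_scale l : measurable_fun setT (scale l).
Proof. exact: (@mulrl_measurable R setT l). Qed.

(** By uniqueness of Lebesgue measure: [l] times the image of [mu] under scaling by [l] gives each
    half-open interval its length. *)
Lemma lebesgue_measure_preimage_scale (l : R) (A : set R) : 0 < l ->
  measurable A -> mu [set x | A (l * x)] = (l^-1%:E * mu A)%E.
Proof.
move=> l0 mA.
pose nu_ : {measure set (measurableTypeR R) -> \bar R} :=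
  mscale (NngNum (ltW l0)) (pushforward mu (scale l)).
pose nu : {measure set (measurableTypeR R) -> \bar R} :=
  nu_ (measurable_scale l).
have : mu A = nu A.
  apply: lebesgue_measure_unique => //= _ [[a b]] _ <-.
  rewrite /mscale/= /pushforward.
  have -> : scale l @^-1` [set` `]a, b]] = [set` `]a / l, b / l]].
    apply/seteqP; split => x; rewrite /scale/= !in_itv/= ltr_pdivrMr// ler_pdivlMr// mulrC//.
  rewrite !lebesgue_measure_itv/= !lte_fin ltr_pM2r ?invr_gt0//.
  case: ifPn => _; last by rewrite mule0.
  by rewrite -EFinM; congr EFin; field; rewrite gt_eqF.
rewrite /nu /= /mscale/= /pushforward => ->.
by rewrite muleA -EFinM mulVf ?gt_eqF// mul1e.
Qed.

End lebesgue_scaling.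

(* Steinhaus' argument: the complements of [V n] and [W n] have small measure, and
   so has the rescaled complement of [V n], hence they cannot cover [1, 2]. *)
Lemma eventually_common_scaling {R : realType} (L : R) (lam : nat -> R)
    (V W : nat -> set R) :
  1 <= L -> (forall n, L^-1 <= lam n <= L) ->
  (forall n, measurable (V n)) -> (forall n, measurable (W n)) ->
  (forall v, L^-1 <= v <= 2 * L -> \forall n \near \oo, V n v) ->
  (forall w, 1 <= w <= 2 -> \forall n \near \oo, W n w) ->
  \forall n \near \oo, exists2 w, 1 <= w <= 2 & V n (lam n * w) /\ W n w.
Proof.
move=> L1 lamL mV mW VE WE.
have L0 : 0 < L by rewrite (lt_le_trans ltr01).
have lam0 n : 0 < lam n.
  by have /andP[+ _] := lamL n; apply: lt_le_trans; rewrite invr_gt0.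
(* The indicators of the complements tend to 0 pointwise, so dominated convergence on the bounded
   interval makes the measures tend to 0. *)
have small (a b : R) (S : nat -> set R) : (forall n, measurable (S n)) ->
    (forall v, a <= v <= b -> \forall n \near \oo, S n v) ->
    forall e, 0 < e ->
    \forall n \near \oo, (lebesgue_measure (`[a, b] `\` S n) < e%:E)%E.
  move=> mS SE e e0.
  have mSC n : measurable (~` S n) by exact: measurableC.
  have mind n : measurable_fun `[a, b] (EFin \o \1_(~` S n) : R -> \bar R).
    by apply/measurable_EFinP; exact: measurable_indic.
  have cvg0 : {ae lebesgue_measure, forall x : R, `[a, b]%classic x ->
      (fun n => EFin (\1_(~` S n) x)) @ \oo --> (0%E : \bar R)}.
    apply: aeW => v /=; rewrite in_itv/= => /SE SEv.
    apply: cvg_near_cst; apply: filterS SEv => n Snv.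
    by rewrite indicE memNset//=; apply.
  have int1 : lebesgue_measure.-integrable `[a, b] (cst 1%E : R -> \bar R).
    apply: (@continuous_compact_integrable _ (cst 1)); first exact: segment_compact.
    exact: cst_continuous.
  have dom : {ae lebesgue_measure, forall (x : R) (n : nat), `[a, b]%classic x ->
      (`|(\1_(~` S n) x)%:E| <= (1 : \bar R))%E}.
    apply: aeW => v /= n _.
    by rewrite indicE; case: (_ \in _); rewrite lee_fin ?normr1 ?normr0.
  have [_ _] := @dominated_convergence _ _ _ (@lebesgue_measure R) `[a, b]
    (measurable_itv _) _ (cst 0%E) _ mind (measurable_cst _) cvg0 int1 dom.
  rewrite integral0 => /fine_cvgP[hfin /cvgr_lt /(_ _ e0) hlt].
  near=> n; have -> : lebesgue_measure (`[a, b] `\` S n) =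
      (\int[lebesgue_measure]_(x in `[a, b]) (EFin \o \1_(~` S n)) x)%E.
    by rewrite integral_indic//; [rewrite setDE setIC|exact: mSC].
  rewrite -[ltLHS]fineK; last by near: n.
  by rewrite lte_fin; near: n.
(* Pulling back by [lam n] multiplies measures by at most [L], so 1/(4L) becomes 1/4. The two
   exceptional sets then have total measure at most 1/2, against length 1 for [1, 2]. *)
have L4 : 0 < (4 * L)^-1 by rewrite invr_gt0 mulr_gt0.
have q4 : (0 : R) < 4^-1 by [].
near=> n.
have hV : (lebesgue_measure (`[(L^-1)%R, (2 * L)%R] `\` V n) < ((4 * L)^-1)%:E)%E.
  by near: n; exact: small.
have hW : (lebesgue_measure (`[1%R, 2%R] `\` W n) < (4^-1)%:E)%E.
  by near: n; exact: small.
apply: contrapT => H.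
pose B1 := `[1%R : R, 2] `\` W n.
pose B2 := [set w | (`[L^-1, 2 * L] `\` V n) (lam n * w)].
have mB1 : measurable B1 by exact: measurableD.
have mB2 : measurable B2.
  have := @mulrl_measurable R setT (lam n) measurableT (`[L^-1, 2 * L] `\` V n).
  by rewrite setTI; apply; exact: measurableD.
have : (lebesgue_measure `[1%R:R, 2%R] <= lebesgue_measure B1 + lebesgue_measure B2)%E.
  apply: le_trans (measureU2 _ _ _) => //.
  apply: le_measure; rewrite ?inE//; first exact: measurableU.
  move=> w /= w12; have := w12; rewrite in_itv/= => /andP[w1 w2].
  apply: contrapT => nB; apply: H; exists w; rewrite ?w1//; split.
    apply: contrapT => nV; apply: nB; right; split => //=; rewrite in_itv/=.
    have /andP[l1 l2] := lamL n.
    apply/andP; split; first by rewrite (le_trans l1)// ler_peMr// ltW.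
    by rewrite [leRHS]mulrC; apply: ler_pM => //; [exact: ltW|exact: le_trans w1].
  by apply: contrapT => nW; apply: nB; left.
apply/negP; rewrite -ltNge lebesgue_measure_preimage_scale//; last exact: measurableD.
rewrite lebesgue_measure_itv/= lte_fin ltr1n -EFinB.
have lamV : (lam n)^-1 <= L by rewrite invf_ple ?posrE//; have /andP[] := lamL n.
apply: (@le_lt_trans _ _ ((4^-1)%:E + L%:E * ((4 * L)^-1)%:E)%E).
  apply: leeD; first exact: ltW.
  by apply: lee_pmul => //; [rewrite lee_fin invr_ge0 ltW|exact: ltW].
rewrite -EFinM -EFinD lte_fin invfM mulrCA divff ?gt_eqF//; lra.
Unshelve. all: by end_near. Qed.

(** * Calculus on the positive half line *)

Section positive_half_line.
Context {R : realType}.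
Implicit Types (f F : R -> R) (a b x l p rho : R).
Notation mu := (@lebesgue_measure R).

Lemma is_derive1_continuous F x (l : R) : is_derive x 1 F l -> {for x, continuous F}.
Proof.
by case=> dF _; apply: differentiable_continuous; exact/derivable1_diffP.
Qed.

Lemma powR_continuous p x : 0 < x -> {for x, continuous (@powR R ^~ p)}.
Proof. by move=> x0; apply: is_derive1_continuous; exact: is_derive1_powR. Qed.

Lemma integral_derive_pos f F a b : 0 < a -> a <= b ->
  (forall x, 0 < x -> is_derive x 1 F (f x)) ->
  (forall x, 0 < x -> {for x, continuous f}) ->
  (\int[mu]_(x in `[a, b]) (f x)%:E = (F b - F a)%:E)%E.
Proof.
move=> a0; rewrite le_eqVlt => /predU1P[<- _ _|ab dF cf].
  by rewrite set_itv1 integral_set1 subrr.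
have pos x : a <= x -> 0 < x by exact: lt_le_trans.
rewrite (@continuous_FTC2 _ f F a b)//.
- apply: continuous_in_subspaceT => x /[!inE]/=.
  by rewrite in_itv/= => /andP[/pos x0 _]; exact: cf.
- split.
  + move=> x; rewrite in_itv/= => /andP[/ltW/pos x0 _].
    by case: (dF _ x0).
  + by apply: cvg_at_right_filter; exact: is_derive1_continuous (dF _ a0).
  + apply: cvg_at_left_filter; apply: is_derive1_continuous (dF _ _).
    exact: lt_trans ab.
- move=> x; rewrite in_itv/= => /andP[/ltW/pos x0 _].
  by rewrite derive1E; case: (dF _ x0).
Qed.

(** Cut at a small [e]: the compact piece is given by the fundamental theorem, and the piece over
    [0, e] vanishes with [e] by integrability. *)
Lemma Rintegral_oc0 f F b l : 0 < b ->
  mu.-integrable `]0, b] (EFin \o f) ->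
  (forall x, 0 < x -> is_derive x 1 F (f x)) ->
  (forall x, 0 < x -> {for x, continuous f}) ->
  F x @[x --> 0^'+] --> l ->
  \int[mu]_(x in `]0, b]) f x = F b - l.
Proof.
move=> b0 intf dF cf Fl.
have mf : measurable_fun `]0, b] f by move: intf => /measurable_int/measurable_EFinP.
have intf' : mu.-integrable `[0, b] (EFin \o f).
  move: intf => /integrableP[mf' fin]; apply/integrableP; split.
    exact/emeasurable_fun_itv_obnd_cbndP.
  rewrite -integral_itv_obnd_cbnd//.
  by apply: measurableT_comp.
have split_int e : 0 < e < b ->
    \int[mu]_(x in `]0, b]) f x = \int[mu]_(x in `[0, e]) f x + (F b - F e).
  move=> /andP[e0 eb].
  rewrite Rintegral_itv_obnd_cbnd//.
  rewrite -(@subrK _ (\int[mu]_(x in `[0, e]) f x) (\int[mu]_(x in `[0, b]) f x)).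
  rewrite Rintegral_itvB ?bnd_simp ?ltW// addrC; congr +%R.
  have sub : `]e, b] `<=` `]0, b] by apply: subset_itvr; rewrite bnd_simp ltW.
  rewrite Rintegral_itv_obnd_cbnd; last exact: integrableS intf.
  by rewrite /Rintegral (@integral_derive_pos f F) ?(ltW eb).
have intl : \int[mu]_(x in `[0, e]) f x + (F b - F e) @[e --> 0^'+] --> 0 + (F b - l).
  apply: cvgD; last by apply: cvgB => //; exact: cvg_cst.
  exact/cvg_at_right_filter/(parameterized_integral_cvg_left b0 intf').
have inte : \int[mu]_(x in `[0, e]) f x + (F b - F e) @[e --> 0^'+] -->
    \int[mu]_(x in `]0, b]) f x.
  apply: cvg_near_cst; near=> e; apply/esym/split_int.
  by apply/andP; split; near: e; [exact: nbhs_right_gt|exact: nbhs_right_lt].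
by rewrite (cvg_unique _ inte intl)// add0r.
Unshelve. all: by end_near. Qed.

Lemma integrable_powR_oc0 p b : -1 < p -> 0 < b ->
  mu.-integrable `]0, b] (fun u => (u `^ p)%:E).
Proof.
move=> p1 b0; have q0 : 0 < p + 1 by lra.
pose F x : R := (p + 1)^-1 * x `^ (p + 1).
have mpow D : measurable_fun D (fun u : R => (u `^ p)%:E).
  by apply/measurable_EFinP; apply: measurable_funTS; exact: measurable_powR.
have dF x : 0 < x -> is_derive x 1 F (x `^ p).
  move=> x0; apply: (is_derive_eq (is_deriveZ (p + 1)^-1 (is_derive1_powR (p + 1) x0))).
  by rewrite addrK /GRing.scale/= mulKf// gt_eqF.
(* Monotone convergence along compact intervals exhausting ]0, b]; on each of them the primitive
   bounds the integral by [F b]. *)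
pose S (n : nat) : set R := `[n.+1%:R^-1, b]%classic.
have S0 n x : S n x -> 0 < x.
  by rewrite /S/= in_itv/= => /andP[+ _]; apply: lt_le_trans; rewrite invr_gt0.
apply/integrableP; split; first exact: mpow.
have -> : `]0, b]%classic = \bigcup_i S i.
  apply/seteqP; split => x /=; rewrite in_itv/=.
    move=> /andP[x0 xb]; exists (Num.truncn x^-1) => //; rewrite /S/= in_itv/= xb andbT.
    by rewrite invf_ple ?posrE// ltW// truncnS_gt.
  by move=> [n _ Sx]; rewrite (S0 _ _ Sx)/=; move: Sx; rewrite /S/= in_itv/= => /andP[].
rewrite (_ : (\int[mu]_(x in _) _)%E =
    (\int[mu]_(x in \bigcup_i S i) (x `^ p)%:E)%E); last first.
  by apply: eq_integral => x _; rewrite gee0_abs// lee_fin powR_ge0.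
have := @ge0_nondecreasing_set_cvg_integral _ (measurableTypeR R) _ S
  (fun u => (u `^ p)%:E) mu.
move=> cvgS; have {}cvgS : (\int[mu]_(x in S i) (x `^ p)%:E)%E @[i --> \oo] -->
    (\int[mu]_(x in \bigcup_i S i) (x `^ p)%:E)%E.
  apply: cvgS => [i j ij|i|i|i x _].
  - apply/subsetPset/subset_itvr; rewrite bnd_simp lef_pV2 ?posrE//.
    by rewrite ler_nat.
  - exact: measurable_itv.
  - exact: mpow.
  - by rewrite lee_fin powR_ge0.
rewrite -(cvg_lim _ cvgS)//.
apply: (@le_lt_trans _ _ (F b)%:E); last exact: ltry.
apply: lime_le; first by apply/cvg_ex; eexists; exact: cvgS.
apply: nearW => n.
have [nb|bn] := leP n.+1%:R^-1 b; last first.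
  rewrite /S set_itv_ge ?bnd_simp -?ltNge// integral_set0 lee_fin.
  by rewrite mulr_ge0 ?powR_ge0// invr_ge0 ltW.
rewrite (@integral_derive_pos _ F)//.
- by rewrite lee_fin gerBl mulr_ge0 ?powR_ge0// invr_ge0 ltW.
- by move=> x; exact: powR_continuous.
Qed.

(** Closed form of the integral of u^(rho - 1) from 1 to x, as shown in [oriented_integral_powR]. *)
Definition rv_kernel rho x : R :=
  if rho == 0 then ln x else (x `^ rho - 1) / rho.

Lemma is_derive_rv_kernel rho x : 0 < x ->
  is_derive x 1 (rv_kernel rho) (x `^ (rho - 1)).
Proof.
move=> x0; rewrite /rv_kernel; case: eqVneq => [->|rho0].
  by rewrite sub0r powR_inv1 ?ltW//; exact: is_derive1_ln.
have := is_deriveZ rho^-1 (is_deriveB (is_derive1_powR rho x0) (is_derive_cst (1 : R) x 1)).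
rewrite (_ : _ \*: _ = fun x => (x `^ rho - 1) / rho); last first.
  by apply/funext => y; rewrite mulrC.
move=> h; apply: (is_derive_eq h); by rewrite subr0 /GRing.scale/= mulKf.
Qed.

Lemma oriented_integral_powR rho x : 0 < x ->
  oriented_integral 1 x (fun u => u `^ (rho - 1)) = rv_kernel rho x.
Proof.
move=> x0; rewrite /oriented_integral.
have k1 : rv_kernel rho 1 = 0.
  by rewrite /rv_kernel ln1 powR1 subrr mul0r if_same.
have d := is_derive_rv_kernel rho.
case: ifPn => [x1|]; rewrite /Rintegral.
  rewrite (@integral_derive_pos _ (rv_kernel rho))//= ?k1 ?subr0// => y y0.
  exact: powR_continuous.
rewrite -ltNge => /ltW x1.
rewrite (@integral_derive_pos _ (rv_kernel rho))//= ?k1 ?sub0r ?opprK// => y y0.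
exact: powR_continuous.
Qed.

End positive_half_line.

(** * Second order regular variation *)

Section second_order_regular_variation.
Context {R : realType}.
Variables (gamma rho : R) (A U : R -> R).
Hypothesis gamma0 : 0 < gamma.
Hypothesis rho0 : rho <= 0.
Hypothesis mU : measurable_fun (`]0, +oo[ : set R) U.
Hypothesis Ugt0 : \forall t \near +oo, 0 < U t.
Hypothesis Und : forall s t, 1 < s -> s <= t -> U s <= U t.
Hypothesis Aneq0 : \forall t \near +oo, A t != 0.
Hypothesis A0 : A t @[t --> +oo] --> 0.
Hypothesis UA : forall x : R, 0 < x ->
  (U (t * x) / U t - x `^ gamma) / A t @[t --> +oo] -->
    x `^ gamma * rv_kernel rho x.

Let D t x := U (t * x) / U t - x `^ gamma.
(* [A] need not be measurable; [S] is a measurable function asymptotically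
   proportional to it. *)
Let S t := D t 2.
Let k2 := 2 `^ gamma * rv_kernel rho 2.

(** Splitting the integral behind the kernel at x gives this cocycle identity, the limit form of
    [Dmul]. *)
Lemma rv_kernelM x y : 0 < x -> 0 < y ->
  rv_kernel rho (x * y) = rv_kernel rho x + x `^ rho * rv_kernel rho y.
Proof.
move=> x0 y0; rewrite /rv_kernel; case: eqVneq => [->|r0].
  by rewrite powRr0 mul1r lnM.
by rewrite powRM ?ltW//; field.
Qed.

Lemma rv_kernel2_gt0 : 0 < rv_kernel rho 2.
Proof.
rewrite /rv_kernel; case: eqVneq => [_|r0]; first by rewrite ln_gt0// ltr1n.
have r1 : rho < 0 by rewrite lt_neqAle r0.
rewrite ltr_ndivlMr// mul0r subr_lt0 /powR pnatr_eq0/=.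
by rewrite expR_lt1 nmulr_rlt0// ln_gt0// ltr1n.
Qed.

Lemma near_pinfty_scale (x : R) (P : R -> Prop) : 0 < x -> (\forall t \near +oo, P t) ->
  \forall t \near +oo, P (t * x).
Proof.
move=> x0 [M [Mr PM]]; exists (M / x); split; first exact: num_real.
by move=> t; rewrite ltr_pdivrMr// => /PM.
Qed.

(** Chains the scales t and t x through U(txy) / U(t) = (U(txy) / U(tx)) (U(tx) / U(t)). Being
    exact, it serves for limits as well as for the local and global bounds. *)
Lemma Dmul t x y : 0 < x -> 0 < y -> U t != 0 -> U (t * x) != 0 ->
  D t (x * y) = y `^ gamma * D t x + D (t * x) y * (U (t * x) / U t).
Proof.
by move=> x0 y0 Ut Utx; rewrite /D powRM ?ltW// (mulrA t); field; rewrite Ut.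
Qed.

Lemma cvgUratio (x : R) : 0 < x -> U (t * x) / U t @[t --> +oo] --> x `^ gamma.
Proof.
move=> x0.
have : (U (t * x) / U t - x `^ gamma) / A t * A t + x `^ gamma @[t --> +oo] -->
    x `^ gamma * rv_kernel rho x * 0 + x `^ gamma.
  by apply: cvgD; [apply: cvgM => //; exact: UA|exact: cvg_cst].
rewrite mulr0 add0r; apply: cvg_trans; apply: near_eq_cvg; near=> t.
by rewrite /= divfK ?subrK//; near: t.
Unshelve. all: by end_near. Qed.

Lemma near_gt0_scale (x : R) : 0 < x -> \forall t \near +oo, 0 < U (t * x).
Proof. by move=> x0; exact: (@near_pinfty_scale x (fun t => 0 < U t)). Qed.

Lemma cvgSA : S t / A t @[t --> +oo] --> k2.
Proof. exact: UA. Qed.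

Lemma k2_gt0 : 0 < k2.
Proof. by rewrite mulr_gt0 ?powR_gt0// rv_kernel2_gt0. Qed.

Lemma Sneq0 : \forall t \near +oo, S t != 0.
Proof.
have h := cvgr_gt _ cvgSA _ k2_gt0.
near=> t.
have : 0 < S t / A t by near: t; exact: h.
by apply: contraTneq => ->; rewrite mul0r ltxx.
Unshelve. all: by end_near. Qed.

(** [Dmul] with y = 2 expresses S(tx) by [D t (x * 2)] and [D t x], whose quotients by [A t]
    converge. By [rv_kernelM] the limit collapses to a pure power, so S is regularly varying of
    index rho. *)
Lemma cvgSscale (x : R) : 0 < x -> S (t * x) / S t @[t --> +oo] --> x `^ rho.
Proof.
move=> x0.
have h1 := UA (mulr_gt0 x0 (ltr0n R 2)).
have h2 : 2 `^ gamma * ((U (t * x) / U t - x `^ gamma) / A t) @[t --> +oo] -->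
    2 `^ gamma * (x `^ gamma * rv_kernel rho x).
  by apply: cvgM; [exact: cvg_cst|exact: UA].
have h3 : (U (t * x) / U t)^-1 @[t --> +oo] --> (x `^ gamma)^-1.
  by apply: cvgV; [rewrite gt_eqF ?powR_gt0|exact: cvgUratio].
have h4 : (S t / A t)^-1 @[t --> +oo] --> k2^-1.
  by apply: cvgV; [rewrite gt_eqF ?k2_gt0|exact: cvgSA].
have : ((U (t * (x * 2)) / U t - (x * 2) `^ gamma) / A t -
      2 `^ gamma * ((U (t * x) / U t - x `^ gamma) / A t)) *
    (U (t * x) / U t)^-1 * (S t / A t)^-1 @[t --> +oo] -->
    ((x * 2) `^ gamma * rv_kernel rho (x * 2) -
      2 `^ gamma * (x `^ gamma * rv_kernel rho x)) * (x `^ gamma)^-1 * k2^-1.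
  by apply: cvgM => //; apply: cvgM => //; exact: cvgB.
rewrite [X in _ --> X](_ : _ = x `^ rho); last first.
  rewrite rv_kernelM// powRM ?ltW// /k2.
  field; have := rv_kernel2_gt0.
  by rewrite !gt_eqF ?powR_gt0//; exact: rv_kernel2_gt0.
apply: cvg_trans; apply: near_eq_cvg; near=> t.
have Ut : U t != 0 by rewrite gt_eqF//; near: t.
have Utx : U (t * x) != 0 by rewrite gt_eqF//; near: t; exact: near_gt0_scale.
have At : A t != 0 by near: t.
have St : S t != 0 by near: t; exact: Sneq0.
rewrite /= -!/(D _ _) Dmul//.
rewrite -/(S (t * x)) -/(S t); field.
by rewrite Ut Utx At St.
Unshelve. all: by end_near. Qed.

Lemma near_le_norm_ratio (f g : R -> R) (l c : R) : `|l| < c ->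
  f t / g t @[t --> +oo] --> l -> (\forall t \near +oo, g t != 0) ->
  \forall t \near +oo, `|f t| <= c * `|g t|.
Proof.
move=> lc fgl g0; have h := cvgr_norm_lt _ fgl _ lc.
near=> t; have gt0 : g t != 0 by near: t.
have : `|f t / g t| < c by near: t; exact: h.
by rewrite normrM normfV ltr_pdivrMr ?normr_gt0// => /ltW.
Unshelve. all: by end_near. Qed.

(** The constant is uniform in v, but the threshold on t is not. The constant comes from maximizing
    the limits of the three ratios, continuous in v, over the compact interval. *)
Lemma near_pointwise_bounds (L : R) : 2 <= L -> exists2 c : R, 0 < c &
  forall v, L^-1 <= v <= 2 * L -> \forall t \near +oo,
    [/\ `|D t v| <= c * `|S t|, `|S (t * v)| <= c * `|S t| &
        `|S t| <= c * `|S (t * v)|].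
Proof.
move=> L2; have L0 : 0 < L by rewrite (lt_le_trans _ L2).
have Lle : L^-1 <= 2 * L.
  by rewrite (@le_trans _ _ 1)// ?invf_le1//; lra.
pose g v := `|v `^ gamma * rv_kernel rho v / k2| + v `^ rho + v `^ (- rho).
have pos v : L^-1 <= v -> 0 < v by apply: lt_le_trans; rewrite invr_gt0.
have cg : {within `[L^-1, 2 * L], continuous g}.
  apply: continuous_in_subspaceT => v /[!inE]/=.
  rewrite in_itv/= => /andP[/pos v0 _].
  apply: cvgD; [apply: cvgD|].
  - apply: cvg_norm; apply: cvgM; last exact: cvg_cst.
    apply: cvgM; first exact: powR_continuous.
    exact: is_derive1_continuous (is_derive_rv_kernel _ _).
  - exact: powR_continuous.
  - exact: powR_continuous.
have [m _ gm] := EVT_max Lle cg.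
have gm0 : 0 <= g m by rewrite !addr_ge0 ?powR_ge0.
exists (g m + 1); first by rewrite ltr_wpDl.
move=> v vL; have := gm v; rewrite in_itv/= => /(_ vL) gv.
have /andP[/pos v0 _] := vL.
have p1 := powR_ge0 v rho; have p2 := powR_ge0 v (- rho).
have n1 := normr_ge0 (v `^ gamma * rv_kernel rho v / k2).
have cD : D t v / S t @[t --> +oo] --> v `^ gamma * rv_kernel rho v / k2.
  have : (D t v / A t) * (S t / A t)^-1 @[t --> +oo] -->
      v `^ gamma * rv_kernel rho v * k2^-1.
    by apply: cvgM; [exact: UA|apply: cvgV; [rewrite gt_eqF ?k2_gt0|exact: cvgSA]].
  apply: cvg_trans; apply: near_eq_cvg; near=> t.
  have At : A t != 0 by near: t.
  by rewrite /= invf_div mulrA divfK.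
have cS' : S t / S (t * v) @[t --> +oo] --> v `^ (- rho).
  rewrite powRN.
  have : (S (t * v) / S t)^-1 @[t --> +oo] --> (v `^ rho)^-1.
    by apply: cvgV; [rewrite gt_eqF ?powR_gt0|exact: cvgSscale].
  by apply: cvg_trans; apply: near_eq_cvg; near=> t; rewrite /= invf_div.
have Sv : \forall t \near +oo, S (t * v) != 0.
  exact: (@near_pinfty_scale _ (fun t => S t != 0) v0 Sneq0).
near=> t; split; near: t.
- apply: near_le_norm_ratio cD Sneq0.
  by rewrite /g in gv *; lra.
- apply: near_le_norm_ratio (cvgSscale v0) Sneq0.
  by rewrite ger0_norm// /g in gv *; lra.
- apply: near_le_norm_ratio cS' Sv.
  by rewrite ger0_norm// /g in gv *; lra.
Unshelve. all: by end_near. Qed.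

Lemma measurable_le_norm (f g : R -> R) : measurable_fun (`]0, +oo[ : set R) f ->
  measurable_fun (`]0, +oo[ : set R) g ->
  measurable (`]0, +oo[%classic `&` [set v | `|f v| <= `|g v|]).
Proof.
move=> mf mg.
have mb := @measurable_fun_ler _ _ _ _ (fun v => `|f v|) (fun v => `|g v|)
  (measurableT_comp (@normr_measurable R setT) mf)
  (measurableT_comp (@normr_measurable R setT) mg).
have := mb (measurable_itv _) [set true] I.
by congr measurable; apply/seteqP; split.
Qed.

(** Squaring brings negative arguments into the range of [powR]; at 0 both sides vanish. *)
Lemma measurable_inv : measurable_fun [set: R] (@GRing.inv R).
Proof.
have -> : @GRing.inv R = (fun x => x * (x ^+ 2) `^ (-1)).
  apply/funext => x; rewrite powR_inv1 ?sqr_ge0//.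
  have [->|x0] := eqVneq x 0; first by rewrite invr0 mul0r.
  by rewrite expr2 invfM mulrA mulfV// mul1r.
apply: measurable_funM => //.
exact: (measurableT_comp (@measurable_powR R (-1)) (@exprn_measurable R setT 2)).
Qed.

Let mUscale (t : R) : 0 < t -> measurable_fun (`]0, +oo[ : set R) (fun v => U (t * v)).
Proof.
move=> t0.
have mt : measurable_fun (`]0, +oo[ : set R) ( *%R t).
  exact: measurable_funTS (@mulrl_measurable R setT t).
have sub : *%R t @` `]0, +oo[%classic `<=` `]0, +oo[%classic.
  by move=> _ [v /= + <-]; rewrite !in_itv/= !andbT => v0; rewrite mulr_gt0.
exact: (measurable_comp (measurable_itv `]0, +oo[) sub mU mt).
Qed.

Let mD (t : R) : 0 < t -> measurable_fun (`]0, +oo[ : set R) (D t).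
Proof.
move=> t0; apply: measurable_funB.
  by apply: measurable_funM; [exact: mUscale|exact: measurable_cst].
exact: (measurable_funTS (@measurable_powR R gamma)).
Qed.

Let mS (t : R) : 0 < t -> measurable_fun (`]0, +oo[ : set R) (fun v => S (t * v)).
Proof.
move=> t0; apply: measurable_funB; last exact: measurable_cst.
have -> : (fun v => U (t * v * 2) / U (t * v)) =
    (fun v => U (t * 2 * v)) \* (GRing.inv \o (fun v => U (t * v))).
  by apply/funext => v /=; rewrite mulrAC.
apply: measurable_funM; first exact: (mUscale (mulr_gt0 t0 (ltr0n R 2))).
apply: measurableT_comp; last exact: mUscale.
exact: measurable_inv.
Qed.

(** If the bound failed along t_n with ratios x_n, a common w in [1, 2] would make the pointwise
    bounds hold both at scale t_n with ratio x_n w and at scale t_n x_n with ratio w. [Dmul] then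
    controls D(t_n, x_n) itself, a contradiction. *)
Lemma local_bound (L : R) : 2 <= L -> exists2 C : R, 0 < C &
  \forall t \near +oo, forall x, L^-1 <= x <= L -> `|D t x| <= C * `|S t|.
Proof.
move=> L2; have L0 : 0 < L by rewrite (lt_le_trans _ L2).
have [c c0 bnd] := near_pointwise_bounds L2.
(* [K] eventually dominates U(tx) / U(t) for x <= L, by monotonicity of U. The cube of [c] comes
   from the chain |D(tx, w)| <= c |S(tx)| <= c^2 |S(txw)| <= c^3 |S(t)|. *)
pose K := L `^ gamma + 1.
pose C := c + c ^+ 3 * K.
have C0 : 0 < C.
  by rewrite ltr_wpDr// mulr_ge0 ?exprn_ge0 ?(ltW c0)// addr_ge0 ?powR_ge0.
exists C => //; apply: contrapT => H.
have /choice[p Hp] : forall n : nat, exists p : R * R,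
    [/\ n%:R < p.1, L^-1 <= p.2 <= L & ~ (`|D p.1 p.2| <= C * `|S p.1|)].
  move=> n; apply: contrapT => nE; apply: H; exists n%:R.
  split; first exact: num_real.
  by move=> t nt x xL; apply: contrapT => nle; apply: nE; exists (t, x).
pose t n := (p n).1; pose x n := (p n).2.
have xL n : L^-1 <= x n <= L by have [] := Hp n.
have x0 n : 0 < x n.
  by have /andP[+ _] := xL n; apply: lt_le_trans; rewrite invr_gt0.
have t0 n : 0 < t n by have [+ _ _] := Hp n; apply: le_lt_trans.
have tx0 n : 0 < t n * x n by rewrite mulr_gt0.
have cvgt : t n @[n --> \oo] --> +oo.
  apply/cvgryPge => M; near=> n.
  have [/ltW + _ _] := Hp n; apply: le_trans.
  by near: n; exact: nbhs_infty_ger.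
have cvgtx : t n * x n @[n --> \oo] --> +oo.
  apply/cvgryPge => M; near=> n.
  have /andP[x1 _] := xL n.
  apply: (@le_trans _ _ (t n * L^-1)); last by rewrite ler_pM2l.
  rewrite ler_pdivlMr//; near: n; exact: (cvgryPge _).1.
(* The intersections with the half line are there because U is only assumed measurable on it. *)
pose V n := (`]0, +oo[%classic `&` [set v | `|D (t n) v| <= `|c * S (t n)|]) `&`
  (`]0, +oo[%classic `&` [set v | `|S (t n * v)| <= `|c * S (t n)|]).
pose W n := (`]0, +oo[%classic `&`
    [set v | `|D (t n * x n) v| <= `|c * S (t n * x n)|]) `&`
  (`]0, +oo[%classic `&` [set v | `|S (t n * x n)| <= `|c * S (t n * x n * v)|]).
have nc u : `|c * u| = c * `|u| by rewrite normrM gtr0_norm.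
have good : \forall n \near \oo, exists2 w, 1 <= w <= 2 & V n (x n * w) /\ W n w.
  apply: (@eventually_common_scaling R L x V W).
- by rewrite (le_trans _ L2)// ler1n.
- exact: xL.
- move=> n; apply: measurableI; apply: measurable_le_norm.
  + exact: mD.
  + exact: measurable_cst.
  + exact: mS.
  + exact: measurable_cst.
- move=> n; apply: measurableI; apply: measurable_le_norm.
  + exact: mD.
  + exact: measurable_cst.
  + exact: measurable_cst.
  + by apply: measurable_funM; [exact: measurable_cst|exact: mS].
- move=> v vL; have v0 : 0 < v.
    by have /andP[+ _] := vL; apply: lt_le_trans; rewrite invr_gt0.
  have h : \forall n \near \oo, [/\ `|D (t n) v| <= c * `|S (t n)|,
      `|S (t n * v)| <= c * `|S (t n)| & `|S (t n)| <= c * `|S (t n * v)|].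
    exact: cvgt _ (bnd v vL).
  apply: filterS h => n [b1 b2 _].
  by rewrite /V/= !nc in_itv/= v0.
- move=> w wL; have w0 : 0 < w by have /andP[+ _] := wL; apply: lt_le_trans.
  have wL' : L^-1 <= w <= 2 * L.
    have /andP[w1 w2] := wL; have Li : L^-1 <= 1 by rewrite invf_le1//; lra.
    by apply/andP; split; lra.
  have h : \forall n \near \oo, [/\ `|D (t n * x n) w| <= c * `|S (t n * x n)|,
      `|S (t n * x n * w)| <= c * `|S (t n * x n)| &
      `|S (t n * x n)| <= c * `|S (t n * x n * w)|].
    exact: cvgtx _ (bnd w wL').
  apply: filterS h => n [b1 _ b3].
  by rewrite /W/= !nc in_itv/= w0.
have K1 : \forall n \near \oo, U (t n * L) / U (t n) <= K.
  have K0 : L `^ gamma < K by rewrite /K ltrDl.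
  exact: cvgt _ (cvgr_le _ (cvgUratio L0) _ K0).
near \oo => n.
have Ut : 0 < U (t n) by near: n; exact: cvgt _ Ugt0.
have Utx : 0 < U (t n * x n) by near: n; exact: cvgtx _ Ugt0.
have tx1 : 1 < t n * x n by near: n; exact: (cvgryPgt _).1.
have [w /andP[w1 w2] [[[_ /= a1] [_ /= a2]] [[_ /= b1] [_ /= b2]]]] :
  exists2 w, 1 <= w <= 2 & V n (x n * w) /\ W n w by near: n.
move: (Hp n) => [_ /andP[_ xnL]]; rewrite -/(t n) -/(x n); apply.
have w0 : 0 < w by exact: lt_le_trans w1.
have := Dmul (x0 n) w0 (lt0r_neq0 Ut) (lt0r_neq0 Utx).
set r := U (t n * x n) / U (t n) => Dxw.
have r0 : 0 <= r by rewrite divr_ge0 ?ltW.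
have rK : r <= K.
  apply: (@le_trans _ _ (U (t n * L) / U (t n))); last by near: n.
  by rewrite ler_pM2r ?invr_gt0//; apply: Und => //; rewrite ler_pM2l.
(* Since w^gamma >= 1, bounding the term of [Dmul] that contains [D t x] bounds [D t x] itself. *)
have wg1 : 1 <= w `^ gamma by rewrite -(powRr0 w) ler_powR// ltW.
apply: (@le_trans _ _ (w `^ gamma * `|D (t n) (x n)|)).
  by rewrite ler_peMl.
rewrite -[w `^ gamma]gtr0_norm ?powR_gt0// -normrM.
rewrite (_ : _ * D _ _ = D (t n) (x n * w) - D (t n * x n) w * r); last first.
  by rewrite Dxw addrK.
apply: (le_trans (ler_normB _ _)).
rewrite normrM (ger0_norm r0) mulrDl.
move: a1 a2 b1 b2; rewrite !nc -mulrA => a1 a2 b1 b2.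
apply: lerD => //.
apply: (@le_trans _ _ (c ^+ 3 * `|S (t n)| * K)); last by rewrite mulrAC.
apply: ler_pM => //.
apply: (le_trans b1); rewrite !exprS expr0 mulr1 -!mulrA ler_pM2l//.
by apply: (le_trans b2); rewrite ler_pM2l.
Unshelve. all: by end_near. Qed.

(** Doubling: D(t, 2y) = y^gamma S(t) + D(2t, y) U(2t) / U(t). Each doubling multiplies the
    inherited bound by at most [q] < 2^theta, which leaves room to absorb the new term y^gamma
    S(t). *)
Lemma global_bound (theta B : R) : gamma < theta -> 1 <= B -> exists2 M : R, 0 < M &
  \forall t \near +oo, forall x, B^-1 <= x -> `|D t x| <= M * x `^ theta * `|S t|.
Proof.
(* With this [L] the interval [1/B, 2] of the base case lies within [1/L, L]. *)
move=> gt B1; pose L := B + 2.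
have L2 : 2 <= L by rewrite /L; lra.
have L0 : 0 < L by lra.
have B0 : 0 < B by lra.
have Bpos x : B^-1 <= x -> 0 < x by apply: lt_le_trans; rewrite invr_gt0.
have [C C0 locC] := local_bound L2.
have lt2 : 2 `^ gamma < 2 `^ theta.
  by rewrite /powR pnatr_eq0/= ltr_expR ltr_pM2r// ln_gt0// ltr1n.
pose q := (2 `^ gamma + 2 `^ theta) / 2.
have q0 : 0 < 2 `^ theta - q by rewrite /q; lra.
(* The first summand covers the base case, because (L x)^theta >= 1 there. The second one gives M
   (2^theta - q) >= 1, the inequality that closes the induction. *)
pose M := C * L `^ theta + (2 `^ theta - q)^-1.
have CL : 0 <= C * L `^ theta by rewrite mulr_ge0 ?powR_ge0// ltW.
have M0 : 0 < M by rewrite ltr_wpDl// invr_gt0.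
exists M => //.
have stepq : \forall t \near +oo, `|S (t * 2) * (U (t * 2) / U t)| <= q * `|S t|.
  apply: (@near_le_norm_ratio _ _ (2 `^ rho * 2 `^ gamma)) Sneq0.
    rewrite ger0_norm ?mulr_ge0 ?powR_ge0//.
    have rho1 : 2 `^ rho <= 1 :> R by rewrite -[leRHS](powRr0 2) ler_powR// ler1n.
    rewrite (@le_lt_trans _ _ (2 `^ gamma))//; last by rewrite /q; lra.
    by rewrite ler_piMl// powR_ge0.
  have : S (t * 2) / S t * (U (t * 2) / U t) @[t --> +oo] --> 2 `^ rho * 2 `^ gamma.
    by apply: cvgM; [exact: cvgSscale|exact: cvgUratio].
  by apply: cvg_trans; apply: near_eq_cvg; near=> t; rewrite /= mulrAC.
have U2 := near_gt0_scale (ltr0n R 2).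
have [N [_ hN]] : \forall t \near +oo, [/\ 0 < U t, 0 < U (t * 2),
    forall x, L^-1 <= x <= L -> `|D t x| <= C * `|S t| &
    `|S (t * 2) * (U (t * 2) / U t)| <= q * `|S t|].
  by near=> t; split; near: t.
exists (Num.max N 1); split; first exact: num_real.
(* [t] is quantified inside the induction since halving x doubles t; a larger t stays beyond the
   same threshold. *)
have step n : forall t x, Num.max N 1 < t -> B^-1 <= x -> x <= 2 ^+ n.+1 ->
    `|D t x| <= M * x `^ theta * `|S t|.
  elim: n => [|n IHn] t x tN Bx xn.
    have /hN[_ _ /(_ x) loc _] : N < t by move: tN; rewrite gt_max => /andP[].
    have Lx : L^-1 <= x.
      by apply: le_trans Bx; rewrite lef_pV2 ?posrE// /L; lra.
    apply: le_trans (loc _) _; first by rewrite Lx/= (le_trans xn)// expr1.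
    rewrite ler_wpM2r//; have x0 := Bpos _ Bx.
    apply: (@le_trans _ _ (C * L `^ theta * x `^ theta)); last first.
      by rewrite ler_wpM2r ?powR_ge0// lerDl invr_ge0 ltW.
    rewrite -mulrA -powRM ?(ltW x0) ?(ltW L0)// ler_peMr// ?(ltW C0)//.
    rewrite -[leLHS](powRr0 (L * x)) ler_powR//; last exact/ltW/(lt_trans gamma0).
    by rewrite -ler_pdivrMl// mulr1.
  have [x2|x2] := leP x 2.
    by apply: IHn => //; rewrite (le_trans x2)// -[leLHS]expr1 ler_weXn2l// ler1n.
  have /hN[Ut U2t _ hq] : N < t by move: tN; rewrite gt_max => /andP[].
  have t1 : 1 < t by move: tN; rewrite gt_max => /andP[].
  pose y := x / 2; have y1 : 1 <= y by rewrite /y; lra.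
  have y0 : 0 < y by lra.
  have -> : x = 2 * y by rewrite /y; lra.
  have := IHn (t * 2) y; have Bi : B^-1 <= 1 by rewrite invf_le1.
  move=> /(_ _ _ _)-/(_ ltac:(by rewrite (lt_trans tN)//; lra)) IH.
  have {}IH : `|D (t * 2) y| <= M * y `^ theta * `|S (t * 2)|.
    by apply: IH; [exact: le_trans y1|rewrite /y ler_pdivrMr// -exprSr].
  rewrite (Dmul (ltr0n R 2) y0) ?gt_eqF// -/(S t) (powRM _ (ler0n R 2) (ltW y0)).
  apply: le_trans (ler_normD _ _) _; rewrite normrM.
  rewrite (ger0_norm (powR_ge0 _ _)).
  have yt0 := powR_ge0 y theta.
  apply: (@le_trans _ _ (y `^ theta * `|S t| + M * y `^ theta * (q * `|S t|))).
    apply: lerD; first by rewrite ler_wpM2r// ler_powR// ltW.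
    rewrite normrM; apply: le_trans (_ : _ <= M * y `^ theta *
      (`|S (t * 2)| * `|U (t * 2) / U t|)) _.
      by rewrite mulrA ler_wpM2r.
    by rewrite -normrM ler_wpM2l// mulr_ge0// ltW.
  have : 1 <= M * (2 `^ theta - q).
    by rewrite /M mulrDl mulVf ?gt_eqF// lerDr mulr_ge0// ltW.
  have Z0 : 0 <= y `^ theta * `|S t| by rewrite mulr_ge0.
  move=> /(ler_wpM2r Z0); rewrite mul1r; set Z := y `^ theta * `|S t|.
  rewrite (_ : M * (2 `^ theta * y `^ theta) * `|S t| =
    M * 2 `^ theta * Z); last by rewrite /Z; ring.
  rewrite (_ : M * y `^ theta * (q * `|S t|) = M * q * Z); last by rewrite /Z; ring.
  by rewrite mulrBr mulrBl; lra.
move=> t tN x Bx; apply: (step (Num.truncn x)) => //.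
rewrite (@le_trans _ _ (Num.truncn x).+1%:R)//; first exact/ltW/truncnS_gt.
by rewrite -natrX ler_nat ltnW// ltn_expl.
Unshelve. all: by end_near. Qed.

(** Returns from S to A at the cost of the factor [k2 + 1], as S / A tends to [k2]. *)
Lemma second_order_domination (theta B : R) : gamma < theta -> 1 <= B ->
  exists2 M : R, 0 < M & \forall t \near +oo, forall x, B^-1 <= x ->
    `|U (t * x) / U t - x `^ gamma| <= M * x `^ theta * `|A t|.
Proof.
move=> gt B1; have [M M0 hM] := global_bound gt B1.
have SA : \forall t \near +oo, `|S t| <= (k2 + 1) * `|A t|.
  apply: near_le_norm_ratio cvgSA Aneq0.
  by rewrite gtr0_norm ?k2_gt0// ltrDl.
exists (M * (k2 + 1)); first by rewrite mulr_gt0// addr_gt0// k2_gt0.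
near=> t => x Bx; have MB : `|D t x| <= M * x `^ theta * `|S t|.
  by move: x Bx; near: t.
apply: le_trans MB _; rewrite -[leRHS]mulrA [in leRHS]mulrACA mulrA.
rewrite [leRHS](_ : _ = M * x `^ theta * ((k2 + 1) * `|A t|)); last by ring.
apply: ler_wpM2l; first by rewrite mulr_ge0 ?powR_ge0// ltW.
by near: t.
Unshelve. all: by end_near. Qed.

(** Apply the global bound at one fixed large [t0] with x = t / t0. With theta = 1/2 it yields U(t)
    = o(t), so that corrections in 1/t are negligible against 1 / U(t). *)
Lemma U_le_powR (theta : R) : gamma < theta -> exists2 K, 0 < K &
  \forall t \near +oo, U t <= K * t `^ theta.
Proof.
move=> gt; have [M M0 hM] := global_bound gt (lexx 1).
near (pinfty_nbhs R) => t0.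
have t00 : 0 < t0 by near: t0; exact: nbhs_pinfty_gt.
have U0 : 0 < U t0 by near: t0.
have hMt : forall x : R, 1^-1 <= x -> `|D t0 x| <= M * x `^ theta * `|S t0|.
  by near: t0; exact: hM.
exists (U t0 * (M * `|S t0| + 1) * t0 `^ (- theta)).
  by rewrite !mulr_gt0 ?powR_gt0// ltr_wpDl// mulr_ge0// ltW.
near=> t.
have tt0 : t0 <= t by near: t; exact: nbhs_pinfty_ge.
pose x := t / t0; have x1 : 1 <= x by rewrite ler_pdivlMr// mul1r.
have -> : t = t0 * x by rewrite /x mulrC divfK// gt_eqF.
rewrite powRM ?(ltW t00) ?(le_trans ler01 x1)//.
have tt : t0 `^ (- theta) * t0 `^ theta = 1.
  by rewrite -powRD ?addNr ?powRr0// (gt_eqF t00) implybT.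
rewrite -!mulrA [t0 `^ (- theta) * _]mulrA tt mul1r.
rewrite -ler_pdivrMl// mulrC.
have := ler_normlW (hMt x _); rewrite invr1 => /(_ x1); rewrite /D lerBlDr => /le_trans; apply.
have : x `^ gamma <= x `^ theta by rewrite ler_powR// ltW.
by rewrite mulrDl mul1r mulrAC; lra.
Unshelve. all: by end_near. Qed.

Lemma cvgU_pinfty : U t @[t --> +oo] --> +oo.
Proof.
have g2 : 1 < 2 `^ gamma :> R.
  by rewrite /powR pnatr_eq0/= expR_gt1 mulr_gt0// ln_gt0// ltr1n.
pose r : R := (1 + 2 `^ gamma) / 2.
have r1 : 1 < r by rewrite /r; lra.
have r2 : r < 2 `^ gamma by rewrite /r; lra.
have hr : \forall t \near +oo, r <= U (t * 2) / U t.
  exact: cvgr_ge _ (cvgUratio (ltr0n R 2)) _ r2.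
have [N [_ hN]] : \forall t \near +oo, 0 < U t /\ r <= U (t * 2) / U t.
  by near=> t; split; near: t.
pose t1 := Num.max N 1 + 1.
have Nt n : N < t1 * 2 ^+ n /\ 1 < t1 * 2 ^+ n.
  have t11 : N < t1 /\ 1 < t1 by split; rewrite /t1 ltr_pwDr// le_max lexx ?orbT.
  have e1 : 1 <= 2 ^+ n :> R by rewrite exprn_ege1// ler1n.
  case: t11 => a b.
  have tle : t1 <= t1 * 2 ^+ n by rewrite ler_peMr// ltW// (lt_trans ltr01).
  by split; [exact: lt_le_trans tle|exact: lt_le_trans tle].
have U1 : 0 < U t1 by have [+ _] := Nt 0%N; rewrite expr0 mulr1 => /hN[].
(* Along t1 2^n the function gains a factor [r] > 1 at each step. Bernoulli's linear lower bound for
   r^n is enough for divergence, and monotonicity fills the gaps between these points. *)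
have grow n : (1 + n%:R * (r - 1)) * U t1 <= U (t1 * 2 ^+ n).
  elim: n => [|n IHn]; first by rewrite mul0r addr0 mul1r expr0 mulr1.
  have [/hN[Un hn] _] := Nt n.
  rewrite exprSr mulrA; move: hn; rewrite ler_pdivlMr// => /(le_trans _); apply.
  apply: (@le_trans _ _ (r * ((1 + n%:R * (r - 1)) * U t1))); last first.
    by rewrite ler_pM2l//; lra.
  rewrite mulrA ler_pM2r// -natr1.
  have n0 : 0 <= n%:R :> R by [].
  have : 0 <= n%:R * (r - 1) * (r - 1) by rewrite !mulr_ge0//; lra.
  by lra.
apply/cvgryPge => b.
pose n := (Num.truncn (b / U t1 / (r - 1))).+1.
have bn : b <= (1 + n%:R * (r - 1)) * U t1.
  rewrite -ler_pdivrMr//.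
  have : b / U t1 / (r - 1) < n%:R by exact: truncnS_gt.
  by rewrite ltr_pdivrMr; lra.
near=> t; apply: (le_trans bn); apply: (le_trans (grow n)).
by apply: Und; [by case: (Nt n)|near: t; apply: nbhs_pinfty_ge; exact: num_real].
Unshelve. all: by end_near. Qed.

End second_order_regular_variation.

(** * Dominated convergence along a real parameter *)

Section dominated_convergence_pinfty.
Context {R : realType}.
Notation mu := (@lebesgue_measure R).

Lemma dominated_cvg_pinfty (D : set R) (f : R -> R -> R) (g l : R -> R) :
  measurable D -> (\forall t \near +oo, measurable_fun D (f t)) ->
  (\forall t \near +oo, forall x, D x -> `|f t x| <= g x) ->
  mu.-integrable D (EFin \o g) -> measurable_fun D l ->
  (forall x, D x -> f t x @[t --> +oo] --> l x) ->
  mu.-integrable D (EFin \o l) /\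
  \int[mu]_(x in D) f t x @[t --> +oo] --> \int[mu]_(x in D) l x.
Proof.
move=> mD mf fg ig ml fl.
have [N [_ hN]] : \forall t \near +oo, measurable_fun D (f t) /\
    forall x, D x -> `|f t x| <= g x.
  by near=> t; split; near: t.
have seq (u : R^nat) : u n @[n --> \oo] --> +oo -> mu.-integrable D (EFin \o l) /\
    \int[mu]_(x in D) f (u n) x @[n --> \oo] --> \int[mu]_(x in D) l x.
  (* Truncating the sequence from below makes measurability and domination hold for every n;
     eventually [v] and [u] agree. *)
  move=> uoo; pose v n := Num.max (u n) (N + 1).
  have Nv n : N < v n by rewrite /v lt_max ltrDl ltr01 orbT.
  have mfv n : measurable_fun D (EFin \o f (v n)).
    by apply/measurable_EFinP; have [] := hN _ (Nv n).
  have uv : \forall n \near \oo, v n = u n.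
    have h := (cvgryPge u).1 uoo (N + 1).
    by near=> n; apply/max_idPl; near: n; exact: h.
  have cvl : {ae mu, forall x, D x -> (fun n => (EFin \o f (v n)) x) @ \oo --> (EFin \o l) x}.
    apply: aeW => x Dx; apply: cvg_EFin; first exact: nearW.
    have : f (u n) x @[n --> \oo] --> l x by exact: (cvg_comp _ _ uoo (fl x Dx)).
    apply: cvg_trans; apply: near_eq_cvg; near=> n.
    by rewrite /=; have -> : v n = u n by near: n.
  have dom : {ae mu, forall x n, D x -> (`|(EFin \o f (v n)) x| <= (EFin \o g) x)%E}.
    by apply: aeW => x n Dx; rewrite lee_fin; have [_] := hN _ (Nv n); apply.
  have [il _ cv] := @dominated_convergence _ _ _ mu D mD (fun n => EFin \o f (v n))
    (EFin \o l) (EFin \o g) mfv (measurableT_comp (@EFin_measurable R setT) ml) cvl ig dom.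
  split => //.
  have : \int[mu]_(x in D) f (v n) x @[n --> \oo] --> \int[mu]_(x in D) l x.
    apply: fine_cvg; rewrite fineK; first exact: cv.
    exact: integrable_fin_num.
  apply: cvg_trans; apply: near_eq_cvg; near=> n.
  by rewrite /=; have -> : v n = u n by near: n.
split; last by apply/cvg_pinftyP => u /seq[].
have cvn : (n%:R : R) @[n --> \oo] --> +oo by apply/cvgryPge; exact: nbhs_infty_ger.
by have [] := seq _ cvn.
Unshelve. all: by end_near. Qed.

End dominated_convergence_pinfty.

(** * Kernels with index [- rho] and their primitives at 0 *)

Section kernel_primitive.
Context {R : realType}.
Variables (rho : R).
Hypothesis rho0 : rho <= 0.
Implicit Types p q x z : R.
Notation mu := (@lebesgue_measure R).

Lemma rv_kernel_ge0_le_ln x : 1 <= x -> 0 <= rv_kernel rho x <= ln x.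
Proof.
move=> x1; rewrite /rv_kernel; case: eqVneq => [_|r0]; first by rewrite ln_ge0/=.
have r1 : rho < 0 by rewrite lt_neqAle r0.
have x0 : 0 < x by exact: lt_le_trans x1.
rewrite ler_ndivlMr// ler_ndivrMr// mul0r subr_le0; apply/andP; split.
  by rewrite -[leRHS](powRr0 x) ler_powR.
by rewrite /powR gt_eqF// lerBrDl mulrC expR_ge1Dx.
Qed.

(** The tail integrals run over z = 1/x, which is why the index changes sign from here on. *)
Lemma rv_kernelV x : 0 < x -> rv_kernel rho x^-1 = - rv_kernel (- rho) x.
Proof.
move=> x0; rewrite /rv_kernel oppr_eq0; case: eqVneq => [_|r0]; first by rewrite lnV.
rewrite [x `^ (- rho)]powRN -powR_inv1 ?(ltW x0)// -powRrM mulN1r powRN.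
by rewrite invrN mulrN opprK.
Qed.

(** Near 0 the kernel is at most logarithmic. Half of the power z^q absorbs the logarithm through -
    ln z <= (2/q) z^(-q/2), and the other half tends to 0. *)
Lemma powR_rv_kernel_cvg0 q : 0 < q -> z `^ q * rv_kernel (- rho) z @[z --> 0^'+] --> 0.
Proof.
move=> q0; have e0 : 0 < q / 2 by rewrite divr_gt0.
have c0 : cst 0 z @[z --> (0 : R)^'+] --> (0 : R) by exact: cvg_cst.
have c1 : - (q / 2)^-1 * z `^ (q / 2) @[z --> (0 : R)^'+] --> (0 : R).
  rewrite -[X in _ --> X](mulr0 (- (q / 2)^-1)).
  by apply: cvgM; [exact: cvg_cst|exact: powR_cvg0].
apply: (squeeze_cvgr _ c1 c0); near=> z; rewrite /=.
  have z0 : 0 < z by near: z; exact: nbhs_right_gt.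
  have z1 : 1 <= z^-1 by rewrite invf_ge1// ltW//; near: z; exact: nbhs_right_lt.
  have /andP[k0 k1] := rv_kernel_ge0_le_ln z1.
  rewrite -[rv_kernel _ z]opprK -rv_kernelV// mulrN mulNr lerN2 oppr_le0.
  rewrite mulr_ge0 ?powR_ge0// andbT.
  rewrite [in leLHS](splitr q) powRD ?(gt_eqF z0) ?implybT// -mulrA mulrC.
  apply: ler_wpM2r; first exact: powR_ge0.
  rewrite mulrC -ler_pdivlMr ?powR_gt0// -powRN; apply: (le_trans k1).
  rewrite ler_pdivlMl// lnV ?posrE//.
  have := expR_ge1Dx (- (q / 2) * ln z).
  by rewrite /powR gt_eqF//; lra.
Unshelve. all: by end_near. Qed.

(* By parts, from the primitive of [z `^ p]. *)
Definition kernel_primitive p z : R :=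
  (p + 1)^-1 *
  (z `^ (p + 1) * ((p + 1 - rho)^-1 * z `^ (- rho) - rv_kernel (- rho) z)).

Lemma is_derive_kernel_primitive p z : 0 < z -> 0 < p + 1 ->
  is_derive z 1 (kernel_primitive p) (z `^ p * - rv_kernel (- rho) z).
Proof.
move=> z0 p1.
have d1 := is_derive1_powR (p + 1) z0.
have d2 := is_deriveZ (p + 1 - rho)^-1 (is_derive1_powR (- rho) z0).
have d3 := is_derive_rv_kernel (- rho) z0.
apply: (is_derive_eq (is_deriveZ (p + 1)^-1 (is_deriveM d1 (is_deriveB d2 d3)))).
rewrite !fctE /GRing.scale/= addrK.
rewrite (_ : z `^ (p + 1) = z `^ p * z); last first.
  by rewrite powRD ?(gt_eqF z0) ?implybT// powRr1// ltW.
rewrite (_ : z `^ (- rho) = z `^ (- rho - 1) * z); last first.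
  rewrite -[X in _ = _ * X](powRr1 (ltW z0)) -powRD ?(gt_eqF z0) ?implybT//.
  by rewrite subrK.
rewrite -[(_ *: _)]/(_ * _).
have pr : 0 < p + 1 - rho by rewrite subr_gt0 (le_lt_trans rho0).
by field; rewrite (gt_eqF pr) (gt_eqF p1).
Qed.

Lemma kernel_primitive_cvg0 p : 0 < p + 1 -> kernel_primitive p z @[z --> 0^'+] --> 0.
Proof.
move=> p1; have pr : 0 < p + 1 - rho by rewrite subr_gt0 (le_lt_trans rho0).
have : (p + 1)^-1 * ((p + 1 - rho)^-1 * z `^ (p + 1 - rho) -
    z `^ (p + 1) * rv_kernel (- rho) z) @[z --> 0^'+] -->
    (p + 1)^-1 * ((p + 1 - rho)^-1 * 0 - 0).
  apply: cvgM; first exact: cvg_cst.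
  apply: cvgB; last exact: powR_rv_kernel_cvg0.
  by apply: cvgM; [exact: cvg_cst|exact: powR_cvg0].
rewrite mulr0 subrr mulr0; apply: cvg_trans; apply: near_eq_cvg; near=> z.
have z0 : 0 < z by near: z; exact: nbhs_right_gt.
rewrite /kernel_primitive [z `^ (p + 1) * (_ - _)]mulrBr; congr (_ * (_ - _)).
by rewrite mulrCA -powRD ?(gt_eqF z0) ?implybT.
Unshelve. all: by end_near. Qed.

End kernel_primitive.

(** * Tail moments *)

Section primitives_vanishing_at_0.
Context {R : realType}.
Implicit Types (f F g G : R -> R) (a b p x z : R).
Notation mu := (@lebesgue_measure R).

(** What makes an integral over ]0, b] equal to [F b], in a form stable under linear combinations,
    so that the limit integrals are read off term by term. *)
Definition primitive0 f F := [/\ forall z, 0 < z -> is_derive z 1 F (f z),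
  forall z, 0 < z -> {for z, continuous f} & F z @[z --> 0^'+] --> 0].

Lemma Rintegral_primitive0 f F b : 0 < b -> primitive0 f F ->
  mu.-integrable `]0, b] (EFin \o f) -> \int[mu]_(x in `]0, b]) f x = F b.
Proof.
by move=> b0 [dF cf F0] intf; rewrite (Rintegral_oc0 b0 intf dF cf F0) subr0.
Qed.

Lemma primitive0D f F g G : primitive0 f F -> primitive0 g G ->
  primitive0 (fun z => f z + g z) (fun z => F z + G z).
Proof.
move=> [dF cf F0] [dG cg G0]; split => [z z0|z z0|].
- exact: (is_deriveD (dF z z0) (dG z z0)).
- exact: (cvgD (cf z z0) (cg z z0)).
- by rewrite -[X in _ --> X](addr0 0); exact: cvgD.
Qed.

Lemma primitive0Z a f F : primitive0 f F ->
  primitive0 (fun z => a * f z) (fun z => a * F z).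
Proof.
move=> [dF cf F0]; split => [z z0|z z0|].
- exact: (is_deriveZ a (dF z z0)).
- by apply: cvgM; [exact: cvg_cst|exact: cf].
- by rewrite -[X in _ --> X](mulr0 a); apply: cvgM => //; exact: cvg_cst.
Qed.

Lemma primitive0_powR p : 0 < p + 1 ->
  primitive0 (@powR R ^~ p) (fun z => (p + 1)^-1 * z `^ (p + 1)).
Proof.
move=> p1; split => [z z0|z z0|].
- apply: (is_derive_eq (is_deriveZ (p + 1)^-1 (is_derive1_powR (p + 1) z0))).
  by rewrite addrK /GRing.scale/= mulKf// gt_eqF.
- exact: powR_continuous.
- rewrite -[X in _ --> X](mulr0 (p + 1)^-1).
  by apply: cvgM; [exact: cvg_cst|exact: powR_cvg0].
Qed.

Lemma primitive0_kernel rho p : rho <= 0 -> 0 < p + 1 ->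
  primitive0 (fun z => z `^ p * - rv_kernel (- rho) z) (kernel_primitive rho p).
Proof.
move=> rho0 p1; split => [z z0|z z0|].
- exact: is_derive_kernel_primitive.
- apply: cvgM; first exact: powR_continuous.
  apply: cvgN; exact: is_derive1_continuous (is_derive_rv_kernel _ z0).
- exact: kernel_primitive_cvg0.
Qed.

End primitives_vanishing_at_0.

Lemma powRV {R : realType} (x p : R) : 0 <= x -> x^-1 `^ p = x `^ (- p).
Proof. by move=> x0; rewrite -powR_inv1// -powRrM mulN1r. Qed.

(** * First order expansion of the squared positive part *)

Section positive_part.
Context {R : realType}.
Implicit Types x y d : R.

Definition pos x : R := Num.max x 0.

Lemma pos_ge0 x : 0 <= pos x. Proof. by rewrite le_max lexx orbT. Qed.

Lemma pos_lipschitz x y : `|pos x - pos y| <= `|x - y|.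
Proof.
rewrite /pos; case: (leP x 0) => ?; case: (leP y 0) => ?;
  rewrite ?subr0 ?sub0r ?subrr ?normr0 ?normr_ge0// ?normrN.
- by rewrite gtr0_norm// ler0_norm; lra.
- by rewrite gtr0_norm// ger0_norm; lra.
Qed.

(** Tangent line inequality for the convex function [pos x ^+ 2], whose derivative is
    [2 * pos x]. *)
Lemma pos_sqr_ge x d : pos x ^+ 2 + 2 * pos x * d <= pos (x + d) ^+ 2.
Proof. by rewrite /pos; case: (leP x 0) => ?; case: (leP (x + d) 0) => ?; nra. Qed.

(** The derivative [2 * pos x] is 2-Lipschitz, so the quadratic remainder bound holds across the
    kink too. *)
Lemma pos_sqr_taylor x d :
  `|pos (x + d) ^+ 2 - pos x ^+ 2 - 2 * pos x * d| <= d ^+ 2.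
Proof.
have := pos_sqr_ge x d => h.
rewrite ger0_norm; last by lra.
by move: h; rewrite /pos; case: (leP x 0) => ?; case: (leP (x + d) 0) => ?; nra.
Qed.

Lemma measurable_pos disp (T : measurableType disp) (D : set T) (f : T -> R) :
  measurable_fun D f -> measurable_fun D (fun w => pos (f w)).
Proof. by move=> mf; apply: measurable_maxr => //; exact: measurable_cst. Qed.

End positive_part.

(** * Moments of U(t/z) / U(t) above the level c *)

Section tail_moments.
Context {R : realType}.
Variables (gamma rho : R) (A U : R -> R).
Hypothesis gamma0 : 0 < gamma.
Hypothesis gamma12 : gamma < 1 / 2.
Hypothesis rho0 : rho <= 0.
Hypothesis mU : measurable_fun (`]0, +oo[ : set R) U.
Hypothesis Ugt0 : \forall t \near +oo, 0 < U t.
Hypothesis Und : forall s t, 1 < s -> s <= t -> U s <= U t.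
Hypothesis Aneq0 : \forall t \near +oo, A t != 0.
Hypothesis A0 : A t @[t --> +oo] --> 0.
Hypothesis UA : forall x : R, 0 < x ->
  (U (t * x) / U t - x `^ gamma) / A t @[t --> +oo] -->
    x `^ gamma * rv_kernel rho x.

Notation mu := (@lebesgue_measure R).
Let b := gamma^-1 - 1.
Let c := b `^ (- gamma).
(** z^(-gamma) exceeds [c] exactly for 0 < z < b. The factor 2 leaves a margin, so that U(t/z) /
    U(t) is below [c] at z = B for large t. *)
Let B := 2 * b.
Let D0 : set R := `]0, B]%classic.
Let G t z := U (t * z^-1) / U t.

Let b1 : 1 < b.
Proof.
have : 2 < gamma^-1.
  by rewrite -[ltLHS]invrK ltf_pV2 ?posrE// -div1r.
by rewrite /b; lra.
Qed.

Let b0 : 0 < b. Proof. exact: lt_trans b1. Qed.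

Let c0 : 0 < c. Proof. exact: powR_gt0. Qed.

Let B1 : 1 <= B. Proof. by rewrite /B; have := b1; lra. Qed.

Let D0gt0 z : D0 z -> 0 < z. Proof. by rewrite /D0/= in_itv/= => /andP[]. Qed.

(** Above gamma for the domination of U(tx) / U(t), below 1/2 for the integrability of z^(-2 theta)
    at 0. *)
Let theta := (gamma + 1 / 2) / 2.

Let gtheta : gamma < theta. Proof. by have := gamma12; rewrite /theta; lra. Qed.

Let theta12 : theta < 1 / 2. Proof. by have := gamma12; rewrite /theta; lra. Qed.

Let int_powR p : -1 < p -> mu.-integrable D0 (EFin \o (@powR R ^~ p)).
Proof. by move=> p1; apply: integrable_powR_oc0 => //; rewrite mulr_gt0. Qed.

Let del t z := G t z - z `^ (- gamma).

Let near_del : exists2 M : R, 0 < M & \forall t \near +oo, forall z, D0 z ->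
  `|del t z| <= M * z `^ (- theta) * `|A t|.
Proof.
have [M M0 hM] := second_order_domination gamma0 rho0 mU Ugt0 Und Aneq0 A0 UA gtheta B1.
exists M => //; apply: filterS hM => t hM z Dz.
have z0 := D0gt0 Dz.
rewrite /del /G -!powRV ?(ltW z0)//; apply: hM.
rewrite lef_pV2 ?posrE//; last exact: lt_le_trans B1.
by move: Dz; rewrite /D0/= in_itv/= => /andP[].
Qed.

Let cvg_del z : D0 z -> del t z / A t @[t --> +oo] -->
  z `^ (- gamma) * - rv_kernel (- rho) z.
Proof.
move=> /D0gt0 z0; have zi : 0 < z^-1 by rewrite invr_gt0.
by have := UA zi; rewrite rv_kernelV// powRV ?ltW.
Qed.

Let mG t : 0 < t -> measurable_fun D0 (G t).
Proof.
move=> t0; rewrite /G; apply: measurable_funM; last exact: measurable_cst.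
have mt : measurable_fun D0 (fun z => t * z^-1).
  apply: measurable_funM; first exact: measurable_cst.
  exact: (measurable_funTS (@measurable_inv R)).
have sub : (fun z => t * z^-1) @` D0 `<=` `]0, +oo[%classic.
  by move=> _ [v /D0gt0 v0 <-]/=; rewrite in_itv/= andbT divr_gt0.
exact: (measurable_comp (measurable_itv `]0, +oo[) sub mU mt).
Qed.

Let mpow p : measurable_fun D0 (@powR R ^~ p).
Proof. exact: (measurable_funTS (@measurable_powR R p)). Qed.

Let le_int (f g : R -> R) : measurable_fun D0 f ->
  (forall z, D0 z -> `|f z| <= g z) -> mu.-integrable D0 (EFin \o g) ->
  mu.-integrable D0 (EFin \o f).
Proof.
move=> mf fg; apply: le_integrable.
- exact: measurable_itv.
- exact/measurable_EFinP.
- by move=> z Dz; rewrite lee_fin (le_trans (fg z Dz))// ler_norm.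
Qed.

Let int_Zl (k : R) (f : R -> R) : mu.-integrable D0 (EFin \o f) ->
  mu.-integrable D0 (EFin \o (fun z => k * f z)).
Proof.
move=> intf; have := @integrableZl _ _ _ mu D0 (measurable_itv _) k _ intf.
by apply: eq_integrable => //; exact: measurable_itv.
Qed.

Let int_D (f g : R -> R) : mu.-integrable D0 (EFin \o f) ->
  mu.-integrable D0 (EFin \o g) -> mu.-integrable D0 (EFin \o (fun z => f z + g z)).
Proof.
move=> intf intg.
have := @integrableD _ _ _ mu D0 (measurable_itv _) _ _ intf intg.
by apply: eq_integrable => //; exact: measurable_itv.
Qed.

Let limit z := pos (z `^ (- gamma) - c).

Let mlimit : measurable_fun D0 limit.
Proof. by apply: measurable_pos; apply: measurable_funB => //; exact: measurable_cst. Qed.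

Let limit_le z : limit z <= z `^ (- gamma).
Proof. by rewrite /limit /pos ge_max powR_ge0 lerBlDr lerDl ltW. Qed.

Let int_limit : mu.-integrable D0 (EFin \o limit).
Proof.
apply: (@le_int _ (@powR R ^~ (- gamma))) => //.
  by move=> z _; rewrite ger0_norm ?pos_ge0.
by apply: int_powR; have := gamma12; lra.
Qed.

Let int_limit2 : mu.-integrable D0 (EFin \o (fun z => limit z ^+ 2)).
Proof.
apply: (@le_int _ (@powR R ^~ (- (gamma + gamma)))).
- exact: measurable_funX.
- move=> z Dz; rewrite opprD powRD ?(gt_eqF (D0gt0 Dz)) ?implybT//.
  rewrite -expr2 ger0_norm ?sqr_ge0// ler_sqr ?nnegrE ?powR_ge0//.
  exact: pos_ge0.
- by apply: int_powR; have := gamma12; lra.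
Qed.

Let near_gt0 : \forall t \near +oo, (0 : R) < t.
Proof. by apply: nbhs_pinfty_gt; exact: num_real. Qed.

(** [pos] is 1-Lipschitz, so the error is at most the integral of [|del t z|], which [near_del]
    controls. *)
Lemma first_moment_bound : exists2 C : R, 0 <= C & \forall t \near +oo,
  mu.-integrable D0 (EFin \o (fun z => pos (G t z - c))) /\
  `|\int[mu]_(z in D0) pos (G t z - c) - \int[mu]_(z in D0) limit z| <= C * `|A t|.
Proof.
have [M M0 hM] := near_del.
have it : mu.-integrable D0 (EFin \o (@powR R ^~ (- theta))).
  by apply: int_powR; have := theta12; lra.
exists (M * \int[mu]_(z in D0) z `^ (- theta)).
  by rewrite mulr_ge0 ?(ltW M0)// Rintegral_ge0// => z _; exact: powR_ge0.
near=> t; have t0 : 0 < t by near: t.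
have del_le : forall z, D0 z -> `|del t z| <= M * `|A t| * z `^ (- theta).
  by move=> z Dz; rewrite mulrAC; move: z Dz; near: t.
have idom : mu.-integrable D0 (EFin \o (fun z => M * `|A t| * z `^ (- theta))).
  exact: int_Zl.
have mf : measurable_fun D0 (fun z => pos (G t z - c)).
  by apply: measurable_pos; apply: measurable_funB; [exact: mG|exact: measurable_cst].
have fdel z : `|pos (G t z - c) - limit z| <= `|del t z|.
  by apply: (le_trans (pos_lipschitz _ _)); rewrite /del opprB addrA subrK.
have idiff : mu.-integrable D0 (EFin \o (fun z => pos (G t z - c) - limit z)).
  apply: le_int idom; first exact: measurable_funB.
  by move=> z Dz; exact: le_trans (del_le z Dz).
have if1 : mu.-integrable D0 (EFin \o (fun z => pos (G t z - c))).
  have := int_D idiff int_limit.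
  by under [X in EFin \o X]eq_fun do rewrite subrK.
have mD0 : measurable (D0 : set (measurableTypeR R)) by exact: measurable_itv.
split; first exact: if1.
rewrite -(RintegralB mD0 if1 int_limit).
apply: (le_trans (le_normr_Rintegral mD0 idiff)).
apply: (@le_trans _ _ (\int[mu]_(z in D0) (M * `|A t| * z `^ (- theta)))).
  apply: (le_Rintegral mD0 _ idom); first exact: (integrable_norm idiff).
  by move=> z Dz; exact: le_trans (del_le z Dz).
by rewrite (RintegralZl _ mD0 it) mulrAC.
Unshelve. all: by end_near. Qed.

(** Formal derivative at A = 0 of the integral of (z^(-gamma) - c + A h(z))_+^2, where h is the
    limit of [del t z / A t]. *)
Definition second_moment_slope :=
  \int[mu]_(z in D0) (2 * limit z * (z `^ (- gamma) * - rv_kernel (- rho) z)).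

Lemma second_moment_expansion : [/\
  mu.-integrable D0 (EFin \o
    (fun z => 2 * limit z * (z `^ (- gamma) * - rv_kernel (- rho) z))),
  (\forall t \near +oo,
    mu.-integrable D0 (EFin \o (fun z => pos (G t z - c) ^+ 2))) &
  (\int[mu]_(z in D0) pos (G t z - c) ^+ 2 - \int[mu]_(z in D0) limit z ^+ 2) / A t
    @[t --> +oo] --> second_moment_slope].
Proof.
have [M M0 hM] := near_del.
pose Q t z := (pos (G t z - c) ^+ 2 - limit z ^+ 2) / A t.
(* Bounds (2 limit |del| + del^2) / |A|, using limit <= z^(-gamma), the bound on [del] and |A| <= 1;
   both exponents exceed -1. *)
pose g z := 2 * M * z `^ (- (theta + gamma)) + M ^+ 2 * z `^ (- (2 * theta)).
have ig : mu.-integrable D0 (EFin \o g).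
  have lt12 := gamma12.
  have i1 : mu.-integrable D0 (EFin \o (@powR R ^~ (- (theta + gamma)))).
    by apply: int_powR; rewrite /theta; lra.
  have i2 : mu.-integrable D0 (EFin \o (@powR R ^~ (- (2 * theta)))).
    by apply: int_powR; rewrite /theta; lra.
  exact: int_D (int_Zl (2 * M) i1) (int_Zl (M ^+ 2) i2).
have Gdel t z : G t z - c = z `^ (- gamma) - c + del t z.
  by rewrite /del; lra.
have A1 : \forall t \near +oo, `|A t| < 1 by exact: cvgr0_norm_lt A0 _ ltr01.
have mQ t : 0 < t -> measurable_fun D0 (Q t).
  move=> t0; apply: measurable_funM; last exact: measurable_cst.
  apply: measurable_funB; apply: measurable_funX => //.
  by apply: measurable_pos; apply: measurable_funB; [exact: mG|exact: measurable_cst].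
have Qg : \forall t \near +oo, forall z, D0 z -> `|Q t z| <= g z.
  near=> t => z Dz; have z0 := D0gt0 Dz.
  have At : 0 < `|A t| by rewrite normr_gt0; near: t.
  have At1 : `|A t| <= 1 by apply: ltW; near: t.
  have dM : `|del t z| <= M * z `^ (- theta) * `|A t| by move: z Dz {z0}; near: t.
  have pz p q : z `^ (- (p + q)) = z `^ (- p) * z `^ (- q).
    by rewrite opprD powRD// (gt_eqF z0) implybT.
  have e2 : 2 * theta = theta + theta by ring.
  rewrite /Q /g Gdel normrM normfV ler_pdivrMr// e2 !pz.
  rewrite -[X in `|X|](subrK (2 * limit z * del t z)).
  apply: (le_trans (ler_normD _ _)).
  apply: (@le_trans _ _ (`|del t z| ^+ 2 + 2 * z `^ (- gamma) * `|del t z|)).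
    apply: lerD; first by rewrite real_normK ?num_real//; exact: pos_sqr_taylor.
    rewrite normrM ler_wpM2r// ger0_norm ?mulr_ge0 ?pos_ge0//.
    by rewrite ler_wpM2l.
  set u := z `^ (- theta); set v := z `^ (- gamma).
  have u0 : 0 <= u by exact: powR_ge0.
  have v0 : 0 <= v by exact: powR_ge0.
  have Mu : 0 <= M * u by rewrite mulr_ge0// ltW.
  rewrite [leLHS]addrC [leRHS]mulrDl. apply: lerD.
    rewrite (_ : 2 * M * (u * v) * `|A t| = 2 * v * (M * u * `|A t|)); last by ring.
    by rewrite ler_wpM2l// mulr_ge0.
  apply: (@le_trans _ _ ((M * u * `|A t|) ^+ 2)).
    by rewrite ler_sqr ?nnegrE ?mulr_ge0// ltW.
  rewrite (_ : M ^+ 2 * (u * u) = (M * u) ^+ 2); last by ring.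
  rewrite exprMn ler_wpM2l ?sqr_ge0//.
  by rewrite expr2 ler_piMr.
have ml : measurable_fun D0
    (fun z => 2 * limit z * (z `^ (- gamma) * - rv_kernel (- rho) z)).
  apply: measurable_funM.
    by apply: measurable_funM; [exact: measurable_cst|exact: mlimit].
  apply: measurable_funM; first exact: mpow.
  apply: measurable_funN; rewrite /rv_kernel; case: eqP => _.
    exact: (measurable_funTS (@measurable_ln R)).
  apply: measurable_funM; last exact: measurable_cst.
  by apply: measurable_funB; [exact: mpow|exact: measurable_cst].
have mD0 : measurable (D0 : set (measurableTypeR R)) by exact: measurable_itv.
have [il cv] : mu.-integrable D0 (EFin \o
    (fun z => 2 * limit z * (z `^ (- gamma) * - rv_kernel (- rho) z))) /\
    \int[mu]_(x in D0) Q t x @[t --> +oo] --> second_moment_slope.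
  apply: (@dominated_cvg_pinfty R D0 Q g _ mD0 _ Qg ig ml).
    by near=> t; apply: mQ; near: t.
  move=> z Dz; have cd := cvg_del Dz.
  pose d t := del t z / A t.
  (* By [pos_sqr_taylor] the nonlinear part of [Q t z] is at most del^2 / |A| = d^2 |A|, and d
     converges while A tends to 0. *)
  have cE : d t ^+ 2 * `|A t| @[t --> +oo] --> (0 : R).
    rewrite -[X in _ --> X](mulr0 ((z `^ (- gamma) * - rv_kernel (- rho) z) ^+ 2)).
    apply: cvgM; first by rewrite !expr2; exact: cvgM.
    by rewrite -(normr0 R); exact: cvg_norm.
  have cEN : - (d t ^+ 2 * `|A t|) @[t --> +oo] --> (0 : R).
    by rewrite -oppr0; exact: cvgN.
  have E0 : Q t z - 2 * limit z * d t @[t --> +oo] --> (0 : R).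
    apply: (squeeze_cvgr _ cEN cE); near=> t.
    have At : A t != 0 by near: t.
    have -> : Q t z - 2 * limit z * d t =
        (pos (G t z - c) ^+ 2 - limit z ^+ 2 - 2 * limit z * del t z) / A t.
      by rewrite /Q /d !mulrA -mulrBl.
    rewrite -ler_norml normrM normfV ler_pdivrMr ?normr_gt0// Gdel.
    apply: (le_trans (pos_sqr_taylor _ _)).
    rewrite -mulrA -expr2 real_normK ?num_real// /d expr_div_n divfK//.
    by rewrite expf_eq0.
  have : Q t z - 2 * limit z * d t + 2 * limit z * d t @[t --> +oo] -->
      0 + 2 * limit z * (z `^ (- gamma) * - rv_kernel (- rho) z).
    by apply: cvgD => //; apply: cvgM; [exact: cvg_cst|exact: cd].
  rewrite add0r; apply: cvg_trans; apply: near_eq_cvg; near=> t.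
  by rewrite /= subrK.
have il2 := int_limit2.
have iQ : \forall t \near +oo, mu.-integrable D0 (EFin \o Q t).
  near=> t; have Qgt : forall z, D0 z -> `|Q t z| <= g z by near: t.
  by apply: le_int ig => //; apply: mQ; near: t.
have if2 : \forall t \near +oo,
    mu.-integrable D0 (EFin \o (fun z => pos (G t z - c) ^+ 2)).
  near=> t; have At : A t != 0 by near: t.
  have iQt : mu.-integrable D0 (EFin \o Q t) by near: t.
  (* Integrability of the square is recovered from that of [Q], as the square equals A Q +
     limit^2. *)
  have := int_D (int_Zl (A t) iQt) il2.
  under [X in EFin \o X]eq_fun do rewrite /Q mulrC divfK// subrK.
  by [].
split => //; apply: cvg_trans cv; apply: near_eq_cvg; near=> t.
have At : A t != 0 by near: t.
have iQt : mu.-integrable D0 (EFin \o Q t) by near: t.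
have if2t : mu.-integrable D0 (EFin \o (fun z => pos (G t z - c) ^+ 2)) by near: t.
rewrite -(RintegralB mD0 if2t il2) /= mulrC -(RintegralZl _ mD0).
  by congr Rintegral; apply/funext => z; rewrite mulrC.
have := int_Zl (A t) iQt.
by under [X in EFin \o X]eq_fun do rewrite /Q mulrC divfK//.
Unshelve. all: by end_near. Qed.

Let Rintegral_support (f g : R -> R) : (forall z, 0 < z <= b -> f z = g z) ->
  (forall z, b < z -> f z = 0) ->
  \int[mu]_(z in D0) f z = \int[mu]_(z in `]0, b]) g z.
Proof.
move=> fg f0.
have <- : \int[mu]_(z in `]0, b]) f z = \int[mu]_(z in `]0, b]) g z.
  by apply: eq_Rintegral => z; rewrite inE/= in_itv/= => /fg.
have -> : `]0, b]%classic = D0 `&` `]0, b]%classic.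
  by rewrite setIidr//; apply: subset_itvl; rewrite bnd_simp /B; have := b0; lra.
rewrite Rintegral_mkcondr; apply: eq_Rintegral => z; rewrite inE => /D0gt0 z0.
rewrite patchE; case: ifPn => // /negP; rewrite inE/= in_itv/= z0/= => /negP.
by rewrite -ltNge => /f0.
Qed.

Let integrable_support (f g : R -> R) : (forall z, 0 < z <= b -> f z = g z) ->
  mu.-integrable D0 (EFin \o f) -> mu.-integrable `]0, b] (EFin \o g).
Proof.
move=> fg intf; apply: (@eq_integrable _ _ _ mu `]0, b]%classic _ (EFin \o f)).
- exact: measurable_itv.
- by move=> z; rewrite inE/= in_itv/= => /fg ->.
- apply: (integrableS _ _ _ intf); [exact: measurable_itv|exact: measurable_itv|].
  by apply: subset_itvl; rewrite bnd_simp /B; have := b0; lra.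
Qed.

Let limitE z : 0 < z <= b -> limit z = z `^ (- gamma) - c.
Proof.
move=> /andP[z0 zb]; rewrite /limit /pos; apply/max_idPl.
rewrite subr_ge0 /c !powRN lef_pV2 ?posrE ?powR_gt0//.
by rewrite ge0_ler_powR ?nnegrE ?(ltW z0) ?(ltW b0) ?(ltW gamma0).
Qed.

Let limit0 z : b < z -> limit z = 0.
Proof.
move=> bz; have z0 : 0 < z by exact: lt_trans bz.
rewrite /limit /pos; apply/max_idPr.
rewrite subr_le0 /c !powRN lef_pV2 ?posrE ?powR_gt0//.
by rewrite ge0_ler_powR ?nnegrE ?(ltW z0) ?(ltW b0) ?(ltW gamma0) ?(ltW bz).
Qed.

Let gp : 0 < - gamma + 1. Proof. by have := gamma12; lra. Qed.
Let g2p : 0 < - (gamma + gamma) + 1. Proof. by have := gamma12; lra. Qed.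
Let zp : (0 : R) < 0 + 1. Proof. by rewrite add0r. Qed.

Let powR_b1 : b `^ (- gamma + 1) = c * b.
Proof. by rewrite powRD ?(gt_eqF b0) ?implybT// powRr1// ltW. Qed.

Let powR_b2 : b `^ (- (gamma + gamma) + 1) = c ^+ 2 * b.
Proof.
rewrite powRD ?(gt_eqF b0) ?implybT// powRr1 ?(ltW b0)// opprD.
by rewrite powRD ?(gt_eqF b0) ?implybT// expr2.
Qed.

(** This fixed point equation is the origin of [c]: the limit of V'(c q_tau) / q_tau is 2c minus
    twice this integral, hence 0. *)
Lemma limit_first_moment : \int[mu]_(z in D0) limit z = c.
Proof.
pose f z : R := 1 * z `^ (- gamma) + - c * z `^ 0.
have Lf z : 0 < z <= b -> limit z = f z.
  by move=> /limitE ->; rewrite /f mul1r powRr0 mulr1.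
rewrite (Rintegral_support Lf limit0).
rewrite (Rintegral_primitive0 b0 (primitive0D (primitive0Z 1 (primitive0_powR gp))
  (primitive0Z (- c) (primitive0_powR zp)))); last exact: integrable_support int_limit.
rewrite powR_b1 add0r powRr1 ?(ltW b0)// invr1 mul1r mul1r.
have g1 : 0 < 1 - gamma by have := gp; lra.
by rewrite /b; field; rewrite ?(gt_eqF gamma0) ?(gt_eqF gp) ?(gt_eqF g1).
Qed.

(** Adding c^2 gives c^2 / (1 - 2 gamma), the square of [beta_coef gamma]. *)
Lemma limit_second_moment :
  \int[mu]_(z in D0) limit z ^+ 2 = c ^+ 2 * (2 * gamma / (1 - 2 * gamma)).
Proof.
pose f z : R := 1 * z `^ (- (gamma + gamma)) +
  (- (2 * c) * z `^ (- gamma) + c ^+ 2 * z `^ 0).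
have Lf z : 0 < z <= b -> limit z ^+ 2 = f z.
  move=> zb; rewrite limitE// /f powRr0 opprD powRD; last first.
    by have /andP[z0 _] := zb; rewrite (gt_eqF z0) implybT.
  by ring.
have L0 z : b < z -> limit z ^+ 2 = 0 by move=> /limit0 ->; rewrite expr0n.
rewrite (Rintegral_support Lf L0).
rewrite (Rintegral_primitive0 b0 (primitive0D (primitive0Z 1 (primitive0_powR g2p))
  (primitive0D (primitive0Z (- (2 * c)) (primitive0_powR gp))
  (primitive0Z (c ^+ 2) (primitive0_powR zp))))); last exact: integrable_support int_limit2.
rewrite powR_b1 powR_b2 add0r powRr1 ?(ltW b0)// invr1 mul1r mul1r.
have g1 : 0 < 1 - gamma by have := gp; lra.
have g2 : 0 < 1 - 2 * gamma by have := g2p; lra.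
by rewrite /b; field; rewrite ?(gt_eqF gamma0) ?(gt_eqF gp) ?(gt_eqF g1) ?(gt_eqF g2).
Qed.

(** The factor before [xi2] is twice the square of [beta_coef gamma]; the later square root removes
    the 2. *)
Lemma second_moment_slopeE : second_moment_slope =
  2 * c ^+ 2 / (1 - 2 * gamma) * xi2 gamma rho.
Proof.
pose f z : R := 2 * (z `^ (- (gamma + gamma)) * - rv_kernel (- rho) z) +
  - (2 * c) * (z `^ (- gamma) * - rv_kernel (- rho) z).
have Lf z : 0 < z <= b ->
    2 * limit z * (z `^ (- gamma) * - rv_kernel (- rho) z) = f z.
  move=> zb; rewrite limitE// /f opprD powRD; last first.
    by have /andP[z0 _] := zb; rewrite (gt_eqF z0) implybT.
  by ring.
have L0 z : b < z -> 2 * limit z * (z `^ (- gamma) * - rv_kernel (- rho) z) = 0.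
  by move=> /limit0 ->; rewrite mulr0 mul0r.
have [il _ _] := second_moment_expansion.
rewrite /second_moment_slope (Rintegral_support Lf L0).
rewrite (Rintegral_primitive0 b0 (primitive0D (primitive0Z 2 (primitive0_kernel rho0 g2p))
  (primitive0Z (- (2 * c)) (primitive0_kernel rho0 gp)))); last exact: integrable_support il.
rewrite /kernel_primitive powR_b1 powR_b2.
(* The last summand of [xi2] is minus the kernel at b, which treats rho = 0 and rho < 0 at once. *)
have -> : xi2 gamma rho = b `^ (- rho) * (2 - 3 * gamma - rho) /
    ((1 - rho - 2 * gamma) * (1 - rho - gamma)) - rv_kernel (- rho) b.
  rewrite /xi2 -/b; congr (_ + _); rewrite /rv_kernel oppr_eq0; case: eqP => // _.
  by rewrite invrN mulrN opprK.
set k := rv_kernel _ _; set w := b `^ (- rho).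
have rho0' := rho0; have gp' := gp; have g2p' := g2p.
have g1 : 0 < 1 - gamma by lra.
have g2 : 0 < 1 - 2 * gamma by lra.
have g3 : 0 < 1 - rho - 2 * gamma by lra.
have g4 : 0 < 1 - rho - gamma by lra.
have g5 : 0 < - gamma + 1 - rho by lra.
have g6 : 0 < - (gamma + gamma) + 1 - rho by lra.
have g7 : 0 < 1 - gamma - rho by lra.
have g8 : 0 < 1 - 2 * gamma - rho by lra.
rewrite {1}/b.
by rewrite /b; field; rewrite ?(gt_eqF gamma0) ?(gt_eqF gp) ?(gt_eqF g1) ?(gt_eqF g2)
 ?(gt_eqF g3) ?(gt_eqF g4) ?(gt_eqF g5) ?(gt_eqF g6) ?(gt_eqF g7) ?(gt_eqF g8).
Qed.

End tail_moments.

(** * The quantile transform *)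

Section quantile_transform.
Context d (T : measurableType d) (R : realType) (P : probability T R).
Variable X : {RV P >-> R}.
Notation mu := (@lebesgue_measure R).

Let F x : R := fine (cdf X x).

Let FE x : (F x)%:E = cdf X x.
Proof. by rewrite /F fineK// fin_num_measure. Qed.

Let F_nd x y : x <= y -> F x <= F y.
Proof. by move=> xy; rewrite -lee_fin !FE; exact: cdf_nondecreasing. Qed.

Let F01 x : 0 <= F x <= 1.
Proof. by rewrite -!lee_fin FE cdf_ge0 cdf_le1. Qed.

(** The limits of F at both infinities make the set nonempty and bounded below; right-continuity
    makes the infimum attained. *)
Lemma quantile_le_iff p x : 0 < p < 1 -> quantile X p <= x <-> p <= F x.
Proof.
move=> /andP[p0 p1]; rewrite /quantile; set S := [set x | _].
have SE y : S y <-> p <= F y by rewrite /S/= -FE lee_fin.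
have S0 : S !=set0.
  have /fine_cvgP[_ /cvgr_ge /(_ _ p1) h] : cdf X @ +oo --> 1%:E by exact: cvg_cdfy1.
  near (pinfty_nbhs R) => y; exists y; apply/SE; near: y; exact: h.
have Slb : has_lbound S.
  have /fine_cvgP[_ /cvgr_lt /(_ _ p0) h] : cdf X @ -oo --> 0%:E by exact: cvg_cdfNy0.
  near (ninfty_nbhs R) => y.
  have yp : F y < p by near: y; exact: h.
  exists y => z /SE pz; rewrite leNgt; apply/negP => /ltW/F_nd zy.
  by move: (lt_le_trans yp (le_trans pz zy)); rewrite ltxx.
split=> [infx|px]; last exact/ge_inf/SE.
have near_x y : x < y -> p <= F y.
  move=> xy; have e0 : 0 < y - inf S by rewrite subr_gt0 (le_lt_trans infx).
  have [z /SE pz zy] := inf_adherent e0 (conj S0 Slb).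
  by apply: (le_trans pz); apply: F_nd; apply: ltW; move: zy; rewrite subrKC.
have /fine_cvgP[_ /= cF] : cdf X y @[y --> x^'+] --> (F x)%:E.
  by rewrite FE; exact: cdf_right_continuous.
rewrite -(cvg_lim _ cF)//; apply: limr_ge; first by apply/cvg_ex; eexists; exact: cF.
by near=> y; apply: near_x; near: y; exact: nbhs_right_gt.
Unshelve. all: by end_near. Qed.

Lemma quantile_nondecreasing p q : 0 < p -> p <= q -> q < 1 ->
  quantile X p <= quantile X q.
Proof.
move=> p0 pq q1; apply/quantile_le_iff; first by rewrite p0 (le_lt_trans pq).
apply: (le_trans pq); apply/quantile_le_iff => //.
by rewrite q1 (lt_le_trans p0).
Qed.

Lemma tail_quantile_nondecreasing s t : 1 < s -> s <= t ->
  tail_quantile X s <= tail_quantile X t.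
Proof.
move=> s1 st; have s0 : 0 < s by exact: lt_trans s1.
have t0 : 0 < t by exact: lt_le_trans st.
apply: quantile_nondecreasing; first by rewrite subr_gt0 invf_lt1.
  by rewrite lerD2l lerN2 lef_pV2.
by rewrite gtrBl invr_gt0.
Qed.

Variable s : R.
Hypothesis s01 : 0 < s < 1.

Let D : set R := `]0, s^-1[%classic.
(** For z uniform on ]0, 1/s[ the level 1 - s z is uniform on ]0, 1[, so [q z] has the law of X.
    Later s = 1/t, and [q z] becomes U(t/z). *)
Let q z := quantile X (1 - s * z).

Let s0 : 0 < s. Proof. by case/andP: s01. Qed.

Let q_gt z x : D z -> (x < q z) <-> (z < (1 - F x) / s).
Proof.
rewrite /D/= in_itv/= => /andP[z0 zs].
have p01 : 0 < 1 - s * z < 1.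
  by rewrite subr_gt0 gtrBl mulr_gt0// mulrC -ltr_pdivlMr// div1r zs.
rewrite ltr_pdivlMr//; split => h.
  rewrite ltNge; apply/negP => h'; move: h; rewrite ltNge => /negP; apply.
  by apply/quantile_le_iff => //; lra.
rewrite ltNge; apply/negP => /(quantile_le_iff _ p01); lra.
Qed.

(** Preimages of rays are intervals of explicit length: this yields both the measurability of [q]
    and its law. *)
Let preimage_q x : D `&` q @^-1` `]x, +oo[ = `]0, (1 - F x) / s[%classic.
Proof.
have /andP[F0 F1] := F01 x.
apply/seteqP; split => z /=.
  move=> [Dz]; rewrite in_itv/= andbT => /(q_gt _ Dz) zF.
  by move: Dz; rewrite /D/= !in_itv/= zF => /andP[-> _].
rewrite in_itv/= => /andP[z0 zF].
have Dz : D z.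
  rewrite /D/= in_itv/= z0/= (lt_le_trans zF)// ler_pdivrMr// mulVf ?gt_eqF//.
  by lra.
by split => //; rewrite in_itv/= andbT; apply/q_gt.
Qed.

Let mq : measurable_fun D q.
Proof.
apply: (measurability (@RGenOInfty.G R)) => [|/= _ [_] [x] -> <-].
  exact: RGenOInfty.measurableE.
by rewrite preimage_q.
Qed.

Let qD := q \_ D.

Let mqD : measurable_fun [set: R] (qD : measurableTypeR R -> R).
Proof. exact: ((measurable_restrictT q (measurable_itv `]0, s^-1[)).1 mq). Qed.

Lemma expectation_quantile (phi : R -> R) :
  measurable_fun [set: R] phi -> (forall x, 0 <= phi x) ->
  ('E_P[phi \o X] = s%:E * \int[mu]_(z in D) (phi (q z))%:E)%E.
Proof.
move=> mphi phi0.
have mphiE : measurable_fun [set: R] (EFin \o phi) by exact/measurable_EFinP.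
have mD : measurable (D : set (measurableTypeR R)) by exact: measurable_itv.
(* Candidate law: Lebesgue measure restricted to [D], pushed forward by [q] extended by 0, then
   scaled by s. It is compared with the law of X on the rays ]x, +oo[, a generating class closed
   under intersection. *)
pose nu1_ : {measure set R -> \bar R} :=
  pushforward (mrestr mu mD) (qD : measurableTypeR R -> R).
pose nu : {measure set R -> \bar R} :=
  mscale (NngNum (ltW s0)) (nu1_ mqD).
have law A : measurable A -> distribution P X A = nu A.
  pose g (n : nat) : set R := `](- n%:R), +oo[%classic.
  apply: (measure_unique (@RGenOInfty.G R) g).
  - exact: RGenOInfty.measurableE.
  - move=> _ _ [x ->] [y ->]; exists (Num.max x y).
    by apply/seteqP; split => z /=; rewrite !in_itv/= !andbT gt_max => /andP.
  - by move=> n; eexists.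
  - rewrite -subTset => x _; exists (Num.truncn (- x)).+1 => //.
    by rewrite /g/= in_itv/= andbT ltrNl truncnS_gt.
  - move=> _ [x ->].
    have /andP[F0 F1] := F01 x.
    rewrite /nu/nu1_/= /mscale/= /pushforward /mrestr.
    have -> : qD @^-1` `]x, +oo[ `&` D = `]0, (1 - F x) / s[%classic.
      rewrite -preimage_q setIC; apply/seteqP; split => z [Dz] /=;
        by rewrite /qD patchE mem_set.
    rewrite lebesgue_measure_itv/= lte_fin.
    have -> : distribution P X `]x, +oo[ = (1 - F x)%:E.
      by rewrite -[LHS]/(ccdf X x) ccdf_1_cdf -FE.
    case: ifPn => [_|].
      by rewrite sube0 -EFinM mulrC divfK// gt_eqF.
    rewrite -leNgt pmulr_lle0 ?invr_gt0// => h.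
    by rewrite mule0; congr EFin; apply/eqP; rewrite eq_le h subr_ge0.
  - by move=> n; rewrite -[ltLHS]/(ccdf X (- n%:R)) ccdf_1_cdf -FE -EFinB ltry.
rewrite unlock.
transitivity (\int[distribution P X]_y (phi y)%:E)%E.
  by rewrite (ge0_integral_distribution X mphiE)// => y; rewrite lee_fin.
transitivity (\int[nu]_y (phi y)%:E)%E.
  by apply: eq_measure_integral => A mA _; exact: law.
rewrite ge0_integral_mscale//; last by move=> y _; rewrite lee_fin.
congr (_ * _)%E.
rewrite ge0_integral_pushforward//=; last by move=> y _; rewrite lee_fin.
rewrite preimage_setT.
(* The complement of [D], where [qD] takes its default value, is null for the restricted measure. *)
transitivity (\int[mrestr mu mD]_(z in setT `\` ~` D) (phi (qD z))%:E)%E.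
  apply: ge0_negligible_integral => //.
  - exact: measurableC.
  - exact: (measurableT_comp mphiE mqD).
  - by move=> z _; rewrite lee_fin.
  - by rewrite /= /mrestr setICl measure0.
rewrite setTD setCK.
transitivity (\int[mu]_(z in D) (phi (qD z))%:E)%E.
  apply: eq_measure_integral => A mA AD.
  by rewrite /= /mrestr setIidl.
by apply: eq_integral => z zD; rewrite /qD patchE zD.
Qed.

End quantile_transform.

(** * The expectile as a minimizer *)

Section expectile_loss.
Context d (T : measurableType d) (R : realType) (P : probability T R).
Variable X : {RV P >-> R}.
Implicit Types (tau x y : R).
Hypothesis Xneg : ('E_P[(fun w => (X^\- w) ^+ 2)%R] < +oo)%E.
Hypothesis Xpos : exists x, ('E_P[(fun w => pos (X w - x) ^+ 2)%R] < +oo)%E.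

Let mX : measurable_fun [set: T] X. Proof. exact: measurable_funPT. Qed.

Let mpos x : measurable_fun [set: T] (fun w => pos (X w - x)).
Proof. by apply: measurable_pos; apply: measurable_funB => //; exact: measurable_cst. Qed.

Let int_le (f g : T -> R) : measurable_fun [set: T] f ->
  P.-integrable [set: T] (EFin \o g) -> (forall w, `|f w| <= g w) ->
  P.-integrable [set: T] (EFin \o f).
Proof.
move=> mf ig fg; apply: le_integrable ig => //.
  exact/measurable_EFinP.
by move=> w _; rewrite lee_fin (le_trans (fg w))// ler_norm.
Qed.

Let int_D (f g : T -> R) : P.-integrable [set: T] (EFin \o f) ->
  P.-integrable [set: T] (EFin \o g) ->
  P.-integrable [set: T] (EFin \o (fun w => f w + g w)).
Proof. by move=> intf intg; exact: (integrableD measurableT intf intg). Qed.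

Let int_Zl k (f : T -> R) : P.-integrable [set: T] (EFin \o f) ->
  P.-integrable [set: T] (EFin \o (fun w => k * f w)).
Proof. by move=> intf; exact: (integrableZl measurableT k intf). Qed.

Let int_cst (k : R) : P.-integrable [set: T] (EFin \o (fun=> k)).
Proof. exact: finite_measure_integrable_cst. Qed.

Let int_of_ge0 (f : T -> R) : measurable_fun [set: T] f -> (forall w, 0 <= f w) ->
  ('E_P[f] < +oo)%E -> P.-integrable [set: T] (EFin \o f).
Proof.
move=> mf f0; rewrite unlock => foo; apply/integrableP; split.
  exact/measurable_EFinP.
rewrite (eq_integral (EFin \o f))// => w _.
by rewrite /= ger0_norm.
Qed.

(** X^2 <= X_-^2 + 2 (X - x)_+^2 + 2 x^2. The second order condition only governs the right tail,
    hence the separate assumption on X_-. *)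
Lemma integrable_sqr : P.-integrable [set: T] (EFin \o (fun w => X w ^+ 2)).
Proof.
have [x hx] := Xpos.
have i1 : P.-integrable [set: T] (EFin \o (fun w => pos (X w - x) ^+ 2)).
  by apply: int_of_ge0 => //; [exact: measurable_funX|move=> w; exact: sqr_ge0].
have i2 : P.-integrable [set: T] (EFin \o (fun w => (X^\- w) ^+ 2)).
  apply: int_of_ge0 => //; last by move=> w; exact: sqr_ge0.
  by apply: measurable_funX; exact: measurable_funrneg.
apply: (int_le _ (int_D i2 (int_D (int_Zl 2 i1) (int_cst (2 * x ^+ 2))))).
  exact: measurable_funX.
move=> w; rewrite ger0_norm ?sqr_ge0// /funrneg /pos.
have := sqr_ge0 (X w - 2 * x).
by case: (leP (- X w) 0) => ?; case: (leP (X w - x) 0) => ?; nra.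
Qed.

Lemma integrable_RV : P.-integrable [set: T] (EFin \o X).
Proof.
apply: (int_le mX (int_D (int_cst 1) integrable_sqr)) => w.
by rewrite -[X in _ <= _ + X]real_normK ?num_real//; nra.
Qed.

Lemma integrable_pos x : P.-integrable [set: T] (EFin \o (fun w => pos (X w - x))).
Proof.
apply: (int_le (mpos x) (int_D (int_cst `|x|) (integrable_norm integrable_RV))) => w.
rewrite ger0_norm ?pos_ge0// /pos ge_max addr_ge0//= andbT.
by rewrite (le_trans (ler_norm _))// (le_trans (ler_normB _ _))// addrC.
Qed.

Lemma integrable_pos_sqr x :
  P.-integrable [set: T] (EFin \o (fun w => pos (X w - x) ^+ 2)).
Proof.
apply: (@int_le _ (fun w => 2 * X w ^+ 2 + 2 * x ^+ 2)).
- exact: measurable_funX.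
- exact: (int_D (int_Zl 2 integrable_sqr) (int_cst _)).
- move=> w; rewrite ger0_norm ?sqr_ge0// /pos.
  have := sqr_ge0 (X w + x).
  by case: (leP (X w - x) 0) => ?; nra.
Qed.

Let m := \int[P]_w X w.
Let m2 := \int[P]_w (X w ^+ 2).
Let N1 x := \int[P]_w pos (X w - x).
Let N2 x := \int[P]_w (pos (X w - x) ^+ 2).

Definition upper_weight tau : R := (2 * tau - 1) / (1 - tau).

(** The function V of the overview, with E[(X - x)^2] expanded in the first two moments of X. *)
Definition scaled_loss tau x :=
  upper_weight tau * N2 x + (m2 - 2 * m * x + x ^+ 2).

Definition scaled_loss_slope tau x := 2 * x - 2 * m - 2 * upper_weight tau * N1 x.

Let N1_ge0 x : 0 <= N1 x.
Proof. by apply: Rintegral_ge0 => w _; exact: pos_ge0. Qed.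

Let N2_ge0 x : 0 <= N2 x.
Proof. by apply: Rintegral_ge0 => w _; exact: sqr_ge0. Qed.

Let N1_noninc x y : x <= y -> N1 y <= N1 x.
Proof.
move=> xy; apply: le_Rintegral => //; [exact: integrable_pos..|].
move=> w _; rewrite /pos; case: (leP (X w - y) 0) => ?; case: (leP (X w - x) 0) => ?; lra.
Qed.

(** The tangent line inequality [pos_sqr_ge] under the expectation; it replaces differentiation
    under the integral sign. *)
Let N2_subgradient x y : N2 y - 2 * N1 y * (x - y) <= N2 x.
Proof.
have := @le_Rintegral _ _ _ P [set: T]
  (fun w => pos (X w - y) ^+ 2 + 2 * (y - x) * pos (X w - y))
  (fun w => pos (X w - x) ^+ 2) measurableT.
rewrite RintegralD//; [|exact: integrable_pos_sqr|exact/int_Zl/integrable_pos].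
rewrite (RintegralZl _ measurableT (integrable_pos y)) => h.
have -> : N2 y - 2 * N1 y * (x - y) = N2 y + 2 * (y - x) * N1 y by ring.
apply: h.
- by apply: int_D; [exact: integrable_pos_sqr|exact/int_Zl/integrable_pos].
- exact: integrable_pos_sqr.
- move=> w _; have := pos_sqr_ge (X w - y) (y - x).
  by rewrite addrA subrK [2 * _ * pos _]mulrAC.
Qed.

(** Two opposite subgradient inequalities bound |N2 x - N2 y| by 2 |x - y| times [N1 (y - 1)], which
    dominates [N1] to the right of y - 1. *)
Let N2_continuous : continuous N2.
Proof.
move=> y; apply/cvgrPdist_le => e e0.
have idy : x @[x --> y] --> y by move=> ?.
have k0 : 0 < 2 * N1 (y - 1) + 1 by rewrite ltr_wpDl// mulr_ge0.
near=> x.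
have xy1 : `|x - y| <= 1 by rewrite distrC; near: x; exact: cvgr_dist_le.
have xyd : 2 * N1 (y - 1) * `|x - y| <= e.
  apply: (@le_trans _ _ ((2 * N1 (y - 1) + 1) * `|x - y|)).
    by rewrite ler_wpM2r// lerDl.
  rewrite mulrC -ler_pdivlMr// distrC; near: x.
  by apply: cvgr_dist_le; [exact: idy|rewrite divr_gt0].
have := N2_subgradient x y; have := N2_subgradient y x.
have Nx : N1 x <= N1 (y - 1).
  by apply: N1_noninc; move: xy1; rewrite ler_norml; lra.
have Ny : N1 y <= N1 (y - 1) by apply: N1_noninc; lra.
have := N1_ge0 x; have := N1_ge0 y.
move: xyd; rewrite ler_norml; have [h|h] := leP 0 (x - y).
  by rewrite ger0_norm//; nra.
by rewrite ltr0_norm//; nra.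
Unshelve. all: by end_near. Qed.

Let scaled_loss_continuous tau : continuous (scaled_loss tau).
Proof.
move=> x; apply: cvgD; first by apply: cvgM; [exact: cvg_cst|exact: N2_continuous].
apply: cvgD; first apply: cvgB; first exact: cvg_cst.
  by apply: cvgM; [exact: cvg_cst|move=> ?].
by rewrite expr2; apply: cvgM; move=> ?.
Qed.

Let weight_ge0 tau : 1 / 2 < tau < 1 -> 0 <= upper_weight tau.
Proof. by move=> /andP[? ?]; rewrite divr_ge0//; lra. Qed.

Let scaled_loss_min tau : 1 / 2 < tau < 1 ->
  exists e, forall x, scaled_loss tau e <= scaled_loss tau x.
Proof.
move=> htau; have k0 := weight_ge0 htau.
(* Outside [m - r, m + r] the term (x - m)^2 is at least r^2 >= r, which exceeds the weighted
   [N2 m]; so the loss there is above its value at m. *)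
pose r := 1 + upper_weight tau * N2 m.
have kN := mulr_ge0 k0 (N2_ge0 m).
have r0 : 0 <= r by rewrite /r; lra.
have [e _ he] : exists2 e, e \in `[m - r, m + r] &
    forall x, x \in `[m - r, m + r] -> scaled_loss tau e <= scaled_loss tau x.
  apply: EVT_min; first by lra.
  exact/continuous_subspaceT/scaled_loss_continuous.
exists e => x; have [xin|xout] := boolP (x \in `[m - r, m + r]); first exact: he.
have mm : m \in `[m - r, m + r] by rewrite in_itv/=; apply/andP; split; lra.
apply: (le_trans (he _ mm)); rewrite /scaled_loss.
have kx := mulr_ge0 k0 (N2_ge0 x).
have : r ^+ 2 <= (x - m) ^+ 2.
  move: xout; rewrite in_itv/= negb_and -!ltNge => /orP[h|h].
    by rewrite -[leRHS]sqrrN ler_sqr ?nnegrE; lra.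
  by rewrite ler_sqr ?nnegrE; lra.
by move: kN kx; rewrite /r; set u := _ * N2 m; nra.
Qed.

Let sqr_integrable x : P.-integrable [set: T] (EFin \o (fun w => (X w - x) ^+ 2)).
Proof.
apply: (@int_le _ (fun w => 2 * X w ^+ 2 + 2 * x ^+ 2)).
- by apply: measurable_funX; apply: measurable_funB => //; exact: measurable_cst.
- exact: (int_D (int_Zl 2 integrable_sqr) (int_cst _)).
- move=> w; rewrite ger0_norm ?sqr_ge0//.
  by have := sqr_ge0 (X w + x); nra.
Qed.

Let Rintegral_sqr x : \int[P]_w ((X w - x) ^+ 2) = m2 - 2 * m * x + x ^+ 2.
Proof.
have -> : (fun w => (X w - x) ^+ 2) = (fun w => X w ^+ 2 + (- (2 * x) * X w + x ^+ 2)).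
  by apply/funext => w; ring.
have i1 := int_Zl (- (2 * x)) integrable_RV; have i2 := int_cst (x ^+ 2).
rewrite (RintegralD measurableT integrable_sqr (int_D i1 i2)).
rewrite (RintegralD measurableT i1 i2).
rewrite (RintegralZl _ measurableT integrable_RV) Rintegral_cst//.
have -> : fine (P [set: T]) = 1 by rewrite probability_setT.
by rewrite -/m -/m2; ring.
Qed.

(** One formula for the loss and for both parts of the deviatile, since a_-^2 = a^2 - a_+^2. *)
Let combination_expectation (a c : R) x (f : T -> R) :
  (forall w, f w = a * pos (X w - x) ^+ 2 + c * (X w - x) ^+ 2) ->
  ('E_P[f])%E = (a * N2 x + c * (m2 - 2 * m * x + x ^+ 2))%:E.
Proof.
move=> fE; have i1 := int_Zl a (integrable_pos_sqr x).
have i2 := int_Zl c (sqr_integrable x).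
have -> : f = (fun w => a * pos (X w - x) ^+ 2 + c * (X w - x) ^+ 2) by exact/funext.
rewrite unlock -[LHS]fineK; last exact: (integrable_fin_num measurableT (int_D i1 i2)).
congr EFin; rewrite -[LHS]/(\int[P]_w (a * pos (X w - x) ^+ 2 + c * (X w - x) ^+ 2)).
rewrite (RintegralD measurableT i1 i2) (RintegralZl _ measurableT (integrable_pos_sqr x)).
by rewrite (RintegralZl _ measurableT (sqr_integrable x)) Rintegral_sqr.
Qed.

Let neg_sqr (a : R) : Num.max (- a) 0 ^+ 2 = a ^+ 2 - pos a ^+ 2.
Proof. by rewrite /pos; case: (leP (- a) 0) => ?; case: (leP a 0) => ?; nra. Qed.

Lemma expectile_lossE tau x : tau < 1 ->
  expectile_loss X tau x = ((1 - tau) * scaled_loss tau x)%:E.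
Proof.
move=> tau1; rewrite /expectile_loss.
rewrite (@combination_expectation (2 * tau - 1) (1 - tau) x).
  by congr EFin; rewrite /scaled_loss /upper_weight; field; lra.
move=> w; rewrite /funrpos /funrneg /= neg_sqr -/(pos _); ring.
Qed.

Lemma deviatile_sqr tau : 1 / 2 < tau < 1 -> exists2 v,
  deviatile X tau = Num.sqrt v &
  forall x, scaled_loss tau x - scaled_loss_slope tau x ^+ 2 / 4 <= v <= scaled_loss tau x.
Proof.
move=> htau; have /andP[tau0 tau1] := htau.
have k0 := weight_ge0 htau.
have emin : forall x, scaled_loss tau (expectile X tau) <= scaled_loss tau x.
  have [e he] := scaled_loss_min htau.
  have : [set e | forall x, (expectile_loss X tau e <= expectile_loss X tau x)%E]
      (expectile X tau).
    (* Existence of a minimizer excludes the default value of [xget]. *)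
    apply: xgetPex; exists e => x; rewrite !expectile_lossE// lee_fin.
    by rewrite ler_pM2l ?subr_gt0.
  move=> /= h x; have := h x; rewrite !expectile_lossE// lee_fin.
  by rewrite ler_pM2l ?subr_gt0.
exists (scaled_loss tau (expectile X tau)) => [|x]; last first.
  rewrite emin andbT; set e := expectile X tau.
  have := ler_wpM2l k0 (N2_subgradient e x).
  rewrite /scaled_loss /scaled_loss_slope.
  set k := upper_weight tau; set n2 := N2 e; set n2' := N2 x; set n1 := N1 x => h.
  (* Completes the square: V(e) >= V(x) + V'(x) (e - x) + (e - x)^2 >= V(x) - V'(x)^2 / 4. *)
  have := sqr_ge0 (2 * (e - x) + (2 * x - 2 * m - 2 * k * n1)).
  nra.
rewrite /deviatile; set e := expectile X tau.
rewrite (@combination_expectation 1 0 e); last first.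
  by move=> w; rewrite mul1r mul0r addr0.
rewrite (@combination_expectation (-1) 1 e); last first.
  by move=> w; rewrite /funrneg/= neg_sqr; ring.
rewrite -EFinM -EFinD/=; congr Num.sqrt.
by rewrite /scaled_loss /upper_weight; field; lra.
Qed.

End expectile_loss.

(** * Asymptotic expansion of the minimum *)

Section asymptotics.
Context {R : realType}.

Lemma cvg0_le (f g : R -> R) : g t @[t --> +oo] --> 0 ->
  (\forall t \near +oo, `|f t| <= g t) -> f t @[t --> +oo] --> 0.
Proof.
move=> g0 fg; have gN : - g t @[t --> +oo] --> 0 by rewrite -oppr0; exact: cvgN.
apply: (squeeze_cvgr _ gN g0); near=> t.
by rewrite -ler_norml; near: t.
Unshelve. all: by end_near. Qed.

(** With r = sqrt(1 + y) the error is - (r - 1)^2 / 2, and |y| = |r - 1| (r + 1) >= |r - 1|. *)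
Lemma sqrt1_taylor (y : R) : -1 <= y -> `|Num.sqrt (1 + y) - 1 - y / 2| <= y ^+ 2 / 2.
Proof.
move=> y1; set r := Num.sqrt _.
have r0 : 0 <= r by exact: sqrtr_ge0.
have y1' : 0 <= 1 + y by lra.
have r2 : r ^+ 2 = 1 + y by rewrite sqr_sqrtr.
have yE : y = r ^+ 2 - 1 by rewrite r2 addrAC subrr add0r.
move: r r0 r2 yE => r r0 r2 ->.
rewrite ler_norml; apply/andP; split; last first.
  by have := sqr_ge0 (r - 1); have := sqr_ge0 (r ^+ 2 - 1); lra.
have : (r - 1) ^+ 2 <= (r - 1) ^+ 2 * (r + 1) ^+ 2.
  by rewrite ler_peMr ?sqr_ge0// exprn_ege1// lerDr.
by lra.
Qed.

Variables (c C K m m2 : R) (A U I1 I2 v : R -> R).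
Hypothesis C0 : 0 <= C.
Hypothesis c0 : 0 < c.
Hypothesis Uoo : U t @[t --> +oo] --> +oo.
Hypothesis Ut0 : U t / t @[t --> +oo] --> 0.
Hypothesis A0 : A t @[t --> +oo] --> 0.
Hypothesis Aneq0 : \forall t \near +oo, A t != 0.
Variable J2 : R.
Hypothesis J20 : 0 <= J2.
Hypothesis cvgI2 : (I2 t - J2) / A t @[t --> +oo] --> K.
Hypothesis cvgI1 : \forall t \near +oo, `|I1 t - c| <= C * `|A t|.

(** Common error scale, which avoids any comparison of 1 / U with A. *)
Let S t := (U t)^-1 + `|A t|.
(** [V t] and [L t] are V(x0) / U(t)^2 and V'(x0) / U(t) at x0 = c U(t). The weight k equals t - 2
    and the tail moments carry a factor 1/t, whence 1 - 2/t. *)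
Let V t := (1 - 2 / t) * I2 t + (m2 / U t ^+ 2 - 2 * m * c / U t + c ^+ 2).
Let L t := 2 * c - 2 * m / U t - 2 * (1 - 2 / t) * I1 t.

Hypothesis vbounds : \forall t \near +oo, V t - L t ^+ 2 / 4 <= v t <= V t.

Let b2 := J2 + c ^+ 2.
Let main t := K * A t - 2 * m * c / U t.

Let b20 : 0 < b2. Proof. by rewrite ltr_wpDl// exprn_gt0. Qed.

Let Ugt0 : \forall t \near +oo, 0 < U t.
Proof. exact: (cvgryPgt _).1 Uoo 0. Qed.

Let tgt0 : \forall t \near +oo, (0 : R) < t.
Proof. by apply: nbhs_pinfty_gt; exact: num_real. Qed.

Let cvgUV : (U t)^-1 @[t --> +oo] --> 0.
Proof. by apply: (gtr0_cvgV0 _).2 => //; exact: Ugt0. Qed.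

Let normA0 : `|A t| @[t --> +oo] --> 0.
Proof. by rewrite -(normr0 R); exact: cvg_norm. Qed.

Let S0 : S t @[t --> +oo] --> 0.
Proof. by rewrite -(addr0 (0 : R)); exact: cvgD. Qed.

Let Sgt0 : \forall t \near +oo, 0 < S t.
Proof.
near=> t; rewrite /S ltr_wpDr// invr_gt0; near: t; exact: Ugt0.
Unshelve. all: by end_near. Qed.

Let cvgI2J2 : I2 t @[t --> +oo] --> J2.
Proof.
have : (I2 t - J2) / A t * A t + J2 @[t --> +oo] --> K * 0 + J2.
  by apply: cvgD; [exact: cvgM|exact: cvg_cst].
rewrite mulr0 add0r; apply: cvg_trans; apply: near_eq_cvg; near=> t.
by rewrite /= divfK ?subrK//; near: t.
Unshelve. all: by end_near. Qed.

(** Besides the o(A) error of [I2], what is left is 2/t = 2 (U(t) / t) / U(t) and m2 / U(t)^2, both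
    o(1 / U(t)). *)
Let value_error : (V t - b2 - main t) / S t @[t --> +oo] --> 0.
Proof.
have g0 : `|(I2 t - J2) / A t - K| + (2 * (U t / t) * `|I2 t| + `|m2| * (U t)^-1)
    @[t --> +oo] --> 0.
  have -> : (0 : R) = `|K - K| + (2 * 0 * `|J2| + `|m2| * 0).
    by rewrite subrr normr0 !mulr0 mul0r !addr0.
  apply: cvgD; first by apply: cvg_norm; apply: cvgB => //; exact: cvg_cst.
  apply: cvgD; last by apply: cvgM => //; exact: cvg_cst.
  apply: cvgM; last exact: cvg_norm.
  by apply: cvgM => //; exact: cvg_cst.
apply: cvg0_le g0 _; near=> t.
have At : A t != 0 by near: t.
have Ut : 0 < U t by near: t; exact: Ugt0.
have St : 0 < S t by near: t; exact: Sgt0.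
have t0 : 0 < t by near: t; exact: tgt0.
have AS : `|A t| <= S t by rewrite /S lerDr invr_ge0 ltW.
have US : (U t)^-1 <= S t by rewrite /S lerDl.
rewrite normrM normfV (gtr0_norm St) ler_pdivrMr//.
have -> : V t - b2 - main t = ((I2 t - J2) / A t - K) * A t +
    (- (2 * (U t / t) * I2 t) * (U t)^-1 + m2 * (U t)^-1 * (U t)^-1).
  by rewrite /V /b2 /main; field; rewrite At !gt_eqF.
apply: (le_trans (ler_normD _ _)); rewrite [leRHS]mulrDl. apply: lerD.
  by rewrite normrM ler_wpM2l.
apply: (le_trans (ler_normD _ _)); rewrite [leRHS]mulrDl; apply: lerD.
  have a0 : 0 <= U t / t by rewrite divr_ge0 ?ltW.
  have u0 : 0 <= (U t)^-1 by rewrite invr_ge0 ltW.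
  move: a0 u0 US; set a := U t / t; set u := (U t)^-1 => a0 u0 US.
  rewrite mulNr normrN 3!normrM (ger0_norm u0) (ger0_norm a0) (ger0_norm (ler0n R 2)).
  by apply: ler_wpM2l => //; rewrite mulr_ge0// mulr_ge0.
have u0 : 0 <= (U t)^-1 by rewrite invr_ge0 ltW.
by rewrite 2!normrM (ger0_norm u0) ler_wpM2l// mulr_ge0.
Unshelve. all: by end_near. Qed.

(** The terms 2c and 2 [I1 t] cancel up to O(A), so [L t] is O(S) and its square is o(S). *)
Let slope_error : L t ^+ 2 / 4 / S t @[t --> +oo] --> 0.
Proof.
pose B t := 2 * C + 2 * `|m| + 4 * (U t / t) * (c + C * `|A t|).
have g0 : B t ^+ 2 / 4 * S t @[t --> +oo] --> 0.
  rewrite -(mulr0 ((2 * C + 2 * `|m| + 4 * 0 * (c + C * 0)) ^+ 2 / 4)).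
  apply: cvgM => //; apply: cvgM; last exact: cvg_cst.
  have BB : B t @[t --> +oo] --> 2 * C + 2 * `|m| + 4 * 0 * (c + C * 0).
    apply: cvgD; first exact: cvg_cst.
    apply: cvgM; first by apply: cvgM => //; exact: cvg_cst.
    by apply: cvgD; [exact: cvg_cst|apply: cvgM => //; exact: cvg_cst].
  by under eq_fun do rewrite expr2; rewrite expr2; exact: cvgM.
apply: cvg0_le g0 _; near=> t.
have Ut : 0 < U t by near: t; exact: Ugt0.
have St : 0 < S t by near: t; exact: Sgt0.
have t0 : 0 < t by near: t; exact: tgt0.
have AS : `|A t| <= S t by rewrite /S lerDr invr_ge0 ltW.
have US : (U t)^-1 <= S t by rewrite /S lerDl.
have I1c : `|I1 t - c| <= C * `|A t| by near: t.
have LB : `|L t| <= B t * S t.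
  have a0 : 0 <= U t / t by rewrite divr_ge0 ?ltW.
  have u0 : 0 <= (U t)^-1 by rewrite invr_ge0 ltW.
  have -> : L t = - (2 * (I1 t - c)) + (- (2 * m * (U t)^-1) +
      4 * (U t / t) * I1 t * (U t)^-1).
    by rewrite /L; field; rewrite !gt_eqF.
  have I1b : `|I1 t| <= c + C * `|A t|.
    rewrite -[I1 t](subrK c) addrC (le_trans (ler_normD _ _))// (gtr0_norm c0).
    by rewrite lerD2l.
  have CA : 0 <= C * `|A t| by rewrite mulr_ge0.
  rewrite (_ : B t * S t = 2 * (C * S t) + (2 * `|m| * S t +
      4 * (U t / t) * (c + C * `|A t|) * S t)); last by rewrite /B; ring.
  apply: (le_trans (ler_normD _ _)); apply: lerD.
    rewrite normrN normrM (ger0_norm (ler0n R 2)) ler_wpM2l//.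
    by rewrite (le_trans I1c)// ler_wpM2l.
  apply: (le_trans (ler_normD _ _)); apply: lerD.
    rewrite normrN 2!normrM (ger0_norm (ler0n R 2)) (ger0_norm u0).
    by rewrite ler_wpM2l// mulr_ge0.
  move: a0 u0 US; set a := U t / t; set u := (U t)^-1 => a0 u0 US.
  rewrite 3!normrM (ger0_norm u0) (ger0_norm a0) (ger0_norm (ler0n R 4)).
  apply: ler_pM => //; first by rewrite mulr_ge0// mulr_ge0.
  by apply: ler_wpM2l => //; rewrite mulr_ge0.
have L2 : L t ^+ 2 <= (B t * S t) ^+ 2.
  by rewrite -[L t ^+ 2]real_normK ?num_real// ler_sqr ?nnegrE// (le_trans _ LB).
rewrite ger0_norm; last by rewrite !divr_ge0 ?sqr_ge0// ltW.
rewrite ler_pdivrMr// ler_pdivrMr//.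
by rewrite (_ : _ * 4 = (B t * S t) ^+ 2)//; field.
Unshelve. all: by end_near. Qed.

Lemma sqrt_expansion :
  (Num.sqrt (v t / b2) - 1 - main t / (2 * b2)) / S t @[t --> +oo] --> 0.
Proof.
pose E t := (v t - b2 - main t) / S t.
have E0 : E t @[t --> +oo] --> 0.
  have g0 : `|(V t - b2 - main t) / S t| + L t ^+ 2 / 4 / S t @[t --> +oo] --> 0.
    rewrite -(addr0 (0 : R)) -{1}(normr0 R).
    by apply: cvgD => //; exact: cvg_norm.
  apply: cvg0_le g0 _; near=> t.
  have St : 0 < S t by near: t; exact: Sgt0.
  have /andP[v1 v2] : V t - L t ^+ 2 / 4 <= v t <= V t by near: t.
  have -> : E t = (V t - b2 - main t) / S t - (V t - v t) / S t.
    by rewrite /E -mulrBl; congr (_ / _); ring.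
  apply: (le_trans (ler_normB _ _)); rewrite lerD2l.
  rewrite ger0_norm; last by rewrite divr_ge0 ?subr_ge0// ltW.
  by rewrite ler_pM2r ?invr_gt0//; lra.
(* Chosen so that |v / b2 - 1| <= S k with k convergent; the quadratic remainder of the square root
   is then O(S^2). *)
pose k t := (`|K| + 2 * `|m| * c + `|E t|) / b2.
have Skt : S t * k t @[t --> +oo] --> 0.
  rewrite -(mul0r ((`|K| + 2 * `|m| * c + `|0 : R|) / b2)).
  apply: cvgM => //; apply: cvgM; last exact: cvg_cst.
  by apply: cvgD; [exact: cvg_cst|exact: cvg_norm].
have kt : k t @[t --> +oo] --> (`|K| + 2 * `|m| * c + `|0 : R|) / b2.
  apply: cvgM; last exact: cvg_cst.
  by apply: cvgD; [exact: cvg_cst|exact: cvg_norm].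
have g0 : S t * k t * k t / 2 + `|E t| / (2 * b2) @[t --> +oo] --> 0.
  have -> : (0 : R) = 0 * ((`|K| + 2 * `|m| * c + `|0 : R|) / b2) / 2 +
      `|0 : R| / (2 * b2) by rewrite normr0 !mul0r addr0.
  apply: cvgD; apply: cvgM; [|exact: cvg_cst| |exact: cvg_cst].
    exact: cvgM.
  exact: cvg_norm.
have Sk1 : \forall t \near +oo, `|S t * k t| < 1 by exact: cvgr0_norm_lt Skt _ ltr01.
apply: cvg0_le g0 _; near=> t.
have Ut : 0 < U t by near: t; exact: Ugt0.
have St : 0 < S t by near: t; exact: Sgt0.
have AS : `|A t| <= S t by rewrite /S lerDr invr_ge0 ltW.
have US : (U t)^-1 <= S t by rewrite /S lerDl.
have u0 : 0 <= (U t)^-1 by rewrite invr_ge0 ltW.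
pose y := v t / b2 - 1.
have yE : y = (main t + E t * S t) / b2.
  by rewrite /y /E; field; rewrite !gt_eqF.
have k0 : 0 <= k t.
  rewrite /k divr_ge0 ?(ltW b20)//.
  by apply: addr_ge0 => //; apply: addr_ge0 => //; rewrite mulr_ge0 ?(ltW c0)// mulr_ge0.
have ySk : `|y| <= S t * k t.
  rewrite yE /k normrM normfV (gtr0_norm b20) mulrA ler_pM2r ?invr_gt0//.
  apply: (le_trans (ler_normD _ _)); rewrite [leRHS]mulrDr; apply: lerD; last first.
    by rewrite normrM (gtr0_norm St) mulrC.
  rewrite /main; apply: (le_trans (ler_normB _ _)); rewrite [leRHS]mulrDr; apply: lerD.
    by rewrite normrM mulrC ler_wpM2r.
  rewrite 3!normrM (ger0_norm u0) (gtr0_norm c0) (ger0_norm (ler0n R 2)) mulrC.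
  by apply: ler_wpM2r => //; rewrite mulr_ge0 ?(ltW c0)// mulr_ge0.
have y1 : -1 <= y.
  have : `|S t * k t| < 1 by near: t.
  rewrite (ger0_norm (mulr_ge0 (ltW St) k0)) => h.
  by have := le_trans ySk (ltW h); rewrite ler_norml => /andP[].
have -> : v t / b2 = 1 + y by rewrite /y addrC subrK.
have -> : (Num.sqrt (1 + y) - 1 - main t / (2 * b2)) / S t =
    (Num.sqrt (1 + y) - 1 - y / 2) / S t + E t / (2 * b2).
  by rewrite yE; field; rewrite !gt_eqF.
apply: (le_trans (ler_normD _ _)); apply: lerD.
  rewrite normrM normfV (gtr0_norm St) ler_pdivrMr//.
  apply: (le_trans (sqrt1_taylor y1)).
  rewrite (_ : _ * S t = (S t * k t) ^+ 2 / 2); last by ring.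
  rewrite ler_pM2r// -[y ^+ 2]real_normK ?num_real//.
  by rewrite ler_sqr ?nnegrE ?(mulr_ge0 (ltW St) k0).
by rewrite normrM normfV (@gtr0_norm _ (2 * b2)) ?mulr_gt0.
Unshelve. all: by end_near. Qed.

End asymptotics.

(** * From the abstract expansion to the deviatile *)

Lemma tail_moment_quantile d (T : measurableType d) (R : realType)
    (P : probability T R) (X : {RV P >-> R}) (n : nat) (t B c : R) :
  1 < t -> 0 < B < t -> 0 < tail_quantile X t ->
  tail_quantile X (t * B^-1) / tail_quantile X t <= c ->
  lebesgue_measure.-integrable `]0, B] (EFin \o (fun z =>
    pos (tail_quantile X (t * z^-1) / tail_quantile X t - c) ^+ n.+1)) ->
  ('E_P[(fun w => pos (X w - c * tail_quantile X t) ^+ n.+1)%R] =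
   (t^-1 * tail_quantile X t ^+ n.+1 *
    \int[lebesgue_measure]_(z in `]0, B])
      pos (tail_quantile X (t * z^-1) / tail_quantile X t - c) ^+ n.+1)%R%:E)%E.
Proof.
move=> t1 /andP[B0 Bt]; set u := tail_quantile X t => u0 uB intf.
have t0 : 0 < t by exact: lt_trans t1.
have ti : 0 < t^-1 < 1 by rewrite invr_gt0 t0 invf_lt1.
pose phi a := pos (a - c * u) ^+ n.+1.
have mphi : measurable_fun [set: R] phi.
  apply: measurable_funX; apply: measurable_pos.
  by apply: measurable_funB; [exact: measurable_id|exact: measurable_cst].
have phi0 a : 0 <= phi a by rewrite exprn_ge0// pos_ge0.
have := expectation_quantile X ti mphi phi0; rewrite /comp invrK => ->.
pose f z := pos (tail_quantile X (t * z^-1) / u - c) ^+ n.+1.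
have phiE z : phi (quantile X (1 - t^-1 * z)) = u ^+ n.+1 * f z.
  have -> : quantile X (1 - t^-1 * z) = tail_quantile X (t * z^-1).
    by rewrite /tail_quantile invf_div mulrC.
  rewrite /phi /f -exprMn; congr (_ ^+ _).
  rewrite /pos maxr_pMr ?(ltW u0)// mulr0; congr Num.max.
  by field; rewrite gt_eqF.
(* By monotonicity the ratio stays below [c] beyond B. The exponent [n.+1] is positive, so that the
   power of 0 is 0. *)
have f0 z : B < z < t -> f z = 0.
  move=> /andP[Bz zt]; have z0 : 0 < z by exact: lt_trans Bz.
  rewrite /f (_ : pos _ = 0) ?expr0n//; apply/max_idPr; rewrite subr_le0.
  apply: le_trans uB; rewrite ler_pM2r ?invr_gt0//.
  apply: tail_quantile_nondecreasing; first by rewrite ltr_pdivlMr// mul1r.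
  by rewrite ler_pM2l// lef_pV2 ?posrE// ltW.
have -> : (\int[lebesgue_measure]_(z in `]0%R, t[) (phi (quantile X (1 - t^-1 * z)))%:E =
    \int[lebesgue_measure]_(z in `]0%R, B]) ((u ^+ n.+1)%:E * (f z)%:E))%E.
  have -> : `]0, B]%classic = `]0, t[%classic `&` `]0, B]%classic.
    by rewrite setIidr//; apply: subset_itvl; rewrite bnd_simp.
  rewrite integral_mkcondr; apply: eq_integral => z; rewrite inE/= in_itv/= => /andP[z0 zt].
  rewrite phiE patchE; case: ifPn => // /negP; rewrite inE/= in_itv/= z0/= => /negP.
  by rewrite -ltNge => Bz; rewrite f0 ?Bz// mulr0.
have mB : measurable (`]0, B]%classic : set (measurableTypeR R)) by exact: measurable_itv.
rewrite (integralZl mB intf) -mulrA !EFinM; congr (_ * (_ * _))%E.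
by rewrite /Rintegral fineK//; exact: integrable_fin_num intf.
Qed.

Lemma cvg_inv_onem {R : realType} : (1 - tau)^-1 @[tau --> (1 : R)^'-] --> +oo.
Proof.
apply/cvgryPge => M; near=> tau.
have M0 : 0 < `|M| + 1 by rewrite ltr_wpDl.
have tau1 : 0 < 1 - tau by rewrite subr_gt0; near: tau; exact: nbhs_left_lt.
rewrite (@le_trans _ _ (`|M| + 1))//.
  by rewrite (le_trans (ler_norm _))// lerDl.
rewrite -[leLHS]invrK lef_pV2 ?posrE ?invr_gt0// lerBlDr -lerBlDl.
apply: ltW; near: tau; apply: nbhs_left_gt.
by rewrite gtrBl invr_gt0 ltr_wpDl.
Unshelve. all: by end_near. Qed.

(** Turns an additive error into the relative form, or leaves it as it is when the coefficient
    vanishes. *)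
Lemma coef_1oE {R : realType} (x e : R) :
  coef_1o x (if x == 0 then e else e / x) = x + e.
Proof.
rewrite /coef_1o; case: eqVneq => [->|x0]; first by rewrite add0r.
by rewrite mulrDr mulr1 mulrCA divff// mulr1.
Qed.

Theorem theorem2 (d : measure_display) (T : measurableType d) (R : realType)
    (P : probability T R) (X : {RV P >-> R}) (gamma rho : R) (A : R -> R)
    (hX : ('E_P[(fun w => (X^\- w) ^+ 2)%R] < +oo)%E)
    (hgamma : 0 < gamma < 1 / 2) (hrho : rho <= 0)
    (hU : second_order_RV gamma rho A (tail_quantile X)) :
  exists w eps1 eps2 : R -> R,
    [/\ eps1 tau @[tau --> 1^'-] --> 0,
        eps2 tau @[tau --> 1^'-] --> 0,
        (\forall tau \near 1^'-,
           deviatile X tau = beta_coef gamma * quantile X tau * (1 + w tau))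
      & (\forall tau \near 1^'-,
           w tau = coef_1o (xi1 X gamma) (eps1 tau) * (quantile X tau)^-1
                 + coef_1o (xi2 gamma rho) (eps2 tau) * A ((1 - tau)^-1))].
Proof.
have /andP[gamma0 gamma12] := hgamma.
have [[mU Ugt0] Asgn A0 UA'] := hU.
have UA (x : R) : 0 < x ->
    (tail_quantile X (t * x) / tail_quantile X t - x `^ gamma) / A t @[t --> +oo] -->
    x `^ gamma * rv_kernel rho x.
  by move=> x0; rewrite -oriented_integral_powR//; exact: UA'.
have Aneq0 : \forall t \near +oo, A t != 0.
  case: Asgn; apply: filterS => t At; [by rewrite gt_eqF|by rewrite lt_eqF].
have Und := @tail_quantile_nondecreasing _ _ _ _ X.
pose U := tail_quantile X.
pose b := gamma^-1 - 1; pose c := b `^ (- gamma); pose B := 2 * b.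
have b1 : 1 < b.
  have : 2 < gamma^-1 by rewrite -[ltLHS]invrK ltf_pV2 ?posrE// -div1r.
  by rewrite /b; lra.
have b0 : 0 < b by exact: lt_trans b1.
have c0 : 0 < c by exact: powR_gt0.
have B0 : 0 < B by rewrite mulr_gt0.
have g2 : 0 < 1 - 2 * gamma by lra.
have Uoo : U t @[t --> +oo] --> +oo.
  exact: (cvgU_pinfty gamma0 Ugt0 Und Aneq0 A0 UA).
have Ut0 : U t / t @[t --> +oo] --> 0.
  have [k k0 hk] := U_le_powR gamma0 hrho mU Ugt0 Und Aneq0 A0 UA gamma12.
  have sqrty : (t : R) `^ (1 / 2) @[t --> +oo] --> +oo.
    apply/cvgryPge => M; near=> t; rewrite div1r powR12_sqrt; last first.
      by near: t; apply: nbhs_pinfty_ge; exact: num_real.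
    apply: (le_trans (ler_norm M)); rewrite -sqrtr_sqr ler_sqrt; last first.
      by near: t; apply: nbhs_pinfty_ge; exact: num_real.
    by near: t; apply: nbhs_pinfty_ge; exact: num_real.
  have sqrt0 : \forall t \near +oo, 0 < (t : R) `^ (1 / 2).
    exact: (cvgryPgt _).1 sqrty 0.
  have g0 : k * ((t : R) `^ (1 / 2))^-1 @[t --> +oo] --> 0.
    rewrite -(mulr0 k); apply: cvgM; first exact: cvg_cst.
    exact: (gtr0_cvgV0 sqrt0).2.
  apply: cvg0_le g0 _; near=> t.
  have t0 : 0 < t by near: t; apply: nbhs_pinfty_gt; exact: num_real.
  have Ut : 0 < U t by near: t.
  have Uk : U t <= k * t `^ (1 / 2) by near: t.
  rewrite gtr0_norm ?divr_gt0// ler_pdivrMr//; apply: (le_trans Uk).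
  rewrite -mulrA ler_pM2l// -ler_pdivrMl ?invr_gt0 ?powR_gt0// invrK.
  by rewrite -powRD ?(gt_eqF t0) ?implybT// -splitr powRr1// ltW.
(* The limit is (2b)^(-gamma), strictly below c = b^(-gamma). *)
have UB : \forall t \near +oo, U (t * B^-1) / U t <= c.
  have Bi : 0 < B^-1 by rewrite invr_gt0.
  apply: (cvgr_le _ (cvgUratio Aneq0 A0 UA Bi)).
  rewrite powRV ?(ltW B0)// /c !powRN ltf_pV2 ?posrE ?powR_gt0//.
  by apply: gt0_ltr_powR; rewrite ?nnegrE ?(ltW b0) ?(ltW B0)// /B; lra.
pose I1 t := \int[lebesgue_measure]_(z in `]0, B]) pos (U (t * z^-1) / U t - c).
pose I2 t := \int[lebesgue_measure]_(z in `]0, B]) pos (U (t * z^-1) / U t - c) ^+ 2.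
have [C C0 hI1] := first_moment_bound gamma0 gamma12 hrho mU Ugt0 Und Aneq0 A0 UA.
rewrite (limit_first_moment gamma0 gamma12) in hI1.
have [_ int2 hI2] := second_moment_expansion gamma0 gamma12 hrho mU Ugt0 Und Aneq0 A0 UA.
rewrite (limit_second_moment gamma0 gamma12) in hI2.
rewrite (second_moment_slopeE gamma0 gamma12 hrho mU Ugt0 Und Aneq0 A0 UA) in hI2.
have tB : \forall t \near +oo, 1 < t /\ 0 < B < t.
  near=> t; split; first by near: t; apply: nbhs_pinfty_gt; exact: num_real.
  by rewrite B0/=; near: t; apply: nbhs_pinfty_gt; exact: num_real.
have E1 : \forall t \near +oo, \int[P]_w pos (X w - c * U t) = t^-1 * U t * I1 t.
  near=> t; have [t1 tBt] : 1 < t /\ 0 < B < t by near: t.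
  have i1 : lebesgue_measure.-integrable `]0, B] (EFin \o (fun z =>
      pos (U (t * z^-1) / U t - c) ^+ 1)).
    have : lebesgue_measure.-integrable `]0, B] (EFin \o (fun z =>
        pos (U (t * z^-1) / U t - c))) /\ `|I1 t - c| <= C * `|A t| by near: t.
    by case.
  have Ut : 0 < U t by near: t.
  have UBt : U (t * B^-1) / U t <= c by near: t.
  have := tail_moment_quantile t1 tBt Ut UBt i1.
  by rewrite unlock /Rintegral => h; rewrite [X in fine X]h.
have E2e : \forall t \near +oo, ('E_P[(fun w => pos (X w - c * U t) ^+ 2)%R] =
    (t^-1 * U t ^+ 2 * I2 t)%:E)%E.
  near=> t; have [t1 tBt] : 1 < t /\ 0 < B < t by near: t.
  by apply: (@tail_moment_quantile _ _ _ _ X 1 t B c) => //; near: t.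
have Xpos : exists x, ('E_P[(fun w => pos (X w - x) ^+ 2)%R] < +oo)%E.
  near (pinfty_nbhs R) => t; exists (c * U t).
  rewrite (_ : 'E_P[_]%E = (t^-1 * U t ^+ 2 * I2 t)%:E); first exact: ltry.
  by near: t.
pose m := \int[P]_w X w; pose m2 := \int[P]_w (X w ^+ 2).
(* t > 2 means tau > 1/2, where the weight k is nonnegative and V convex; elsewhere [v] is an
   irrelevant default. *)
have dev (t : R) : exists v, 2 < t ->
    deviatile X (1 - t^-1) = Num.sqrt v /\
    forall x, scaled_loss X (1 - t^-1) x - scaled_loss_slope X (1 - t^-1) x ^+ 2 / 4
      <= v <= scaled_loss X (1 - t^-1) x.
  have [t2|_] := ltP 2 t; last by exists 0.
  have htau : 1 / 2 < 1 - t^-1 < 1.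
    have ti : 0 < t^-1 by rewrite invr_gt0 (lt_trans _ t2).
    have : t^-1 < 2^-1 by rewrite ltf_pV2 ?posrE// (lt_trans _ t2).
    by move=> ?; apply/andP; split; lra.
  by have [v ? ?] := deviatile_sqr hX Xpos htau; exists v.
have {dev}[v dev] := choice dev.
pose K := 2 * c ^+ 2 / (1 - 2 * gamma) * xi2 gamma rho.
pose J2 := c ^+ 2 * (2 * gamma / (1 - 2 * gamma)).
have vbounds : \forall t \near +oo,
  (1 - 2 / t) * I2 t + (m2 / U t ^+ 2 - 2 * m * c / U t + c ^+ 2) -
    (2 * c - 2 * m / U t - 2 * (1 - 2 / t) * I1 t) ^+ 2 / 4 <= v t / U t ^+ 2 <=
  (1 - 2 / t) * I2 t + (m2 / U t ^+ 2 - 2 * m * c / U t + c ^+ 2).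
  near=> t.
  have t2 : 2 < t by near: t; apply: nbhs_pinfty_gt; exact: num_real.
  have t0 : 0 < t by exact: lt_trans t2.
  have Ut : 0 < U t by near: t.
  have E1t : \int[P]_w pos (X w - c * U t) = t^-1 * U t * I1 t by near: t.
  have E2t : \int[P]_w (pos (X w - c * U t) ^+ 2) = t^-1 * U t ^+ 2 * I2 t.
    have : ('E_P[(fun w => pos (X w - c * U t) ^+ 2)%R] =
      (t^-1 * U t ^+ 2 * I2 t)%:E)%E by near: t.
    by rewrite unlock /Rintegral => h; rewrite [X in fine X]h.
  have [_ /(_ (c * U t))] := dev t t2.
  have kE : upper_weight (1 - t^-1) = t - 2.
    by rewrite /upper_weight subKr invrK; field; rewrite gt_eqF.
  have -> : scaled_loss X (1 - t^-1) (c * U t) = U t ^+ 2 *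
      ((1 - 2 / t) * I2 t + (m2 / U t ^+ 2 - 2 * m * c / U t + c ^+ 2)).
    rewrite /scaled_loss kE E2t -/m -/m2.
    by field; rewrite !gt_eqF.
  have -> : scaled_loss_slope X (1 - t^-1) (c * U t) = U t *
      (2 * c - 2 * m / U t - 2 * (1 - 2 / t) * I1 t).
    rewrite /scaled_loss_slope kE E1t -/m.
    by field; rewrite !gt_eqF.
  have U2 : 0 < U t ^+ 2 by rewrite exprn_gt0.
  rewrite exprMn -[X in _ - X <= _]mulrA -mulrBr => /andP[v1 v2].
  by rewrite ler_pdivlMr// ler_pdivrMr// ![_ * U t ^+ 2]mulrC v1.
have J20 : 0 <= J2 by rewrite /J2 mulr_ge0 ?sqr_ge0// divr_ge0 ?(ltW g2)// mulr_ge0// ltW.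
have hI1' : \forall t \near +oo, `|I1 t - c| <= C * `|A t|.
  by apply: filterS hI1 => t [].
have := sqrt_expansion C0 c0 Uoo Ut0 A0 Aneq0 J20 hI2 hI1' vbounds.
move=> h0.
pose beta := beta_coef gamma.
have sg : 0 < Num.sqrt (1 - 2 * gamma) by rewrite sqrtr_gt0.
have beta0 : 0 < beta by rewrite /beta /beta_coef -/b -/c divr_gt0.
have beta2 : J2 + c ^+ 2 = beta ^+ 2.
  rewrite /beta /beta_coef -/b -/c expr_div_n sqr_sqrtr ?(ltW g2)// /J2.
  by field; rewrite gt_eqF.
have c2b : beta ^+ 2 * (1 - 2 * gamma) = c ^+ 2.
  by rewrite -beta2 /J2; field; rewrite gt_eqF.
have xi1E : xi1 X gamma = - (m * c / beta ^+ 2).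
  rewrite /xi1 -/b unlock -/(Rintegral P setT X) -/m.
  have -> : b `^ gamma = c^-1 by rewrite /c powRN invrK.
  have -> : beta ^+ 2 = c ^+ 2 / (1 - 2 * gamma).
    by rewrite -c2b mulfK// gt_eqF.
  by field; rewrite !gt_eqF.
(* Error relative to the common scale. It agrees with the expansion of the square root because K = 2
   beta^2 xi2 and xi1 = - m c / beta^2. *)
pose eta t := (deviatile X (1 - t^-1) / (beta * U t) - 1 -
  (xi1 X gamma * (U t)^-1 + xi2 gamma rho * A t)) / ((U t)^-1 + `|A t|).
have eta0 : eta t @[t --> +oo] --> 0.
  apply: cvg_trans h0; apply: near_eq_cvg; near=> t.
  have t2 : 2 < t by near: t; apply: nbhs_pinfty_gt; exact: num_real.
  have Ut : 0 < U t by near: t.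
  have bU : 0 < beta * U t by rewrite mulr_gt0.
  rewrite /= /eta beta2; congr ((_ - _ - _) / _).
    have [-> _] := dev t t2.
    have vE : v t = (beta * U t) ^+ 2 * (v t / U t ^+ 2 / beta ^+ 2).
      by field; rewrite !gt_eqF.
    rewrite [in RHS]vE [in RHS]sqrtrM ?sqr_ge0// sqrtr_sqr gtr0_norm//.
    by rewrite [RHS]mulrAC divff ?(gt_eqF bU)// mul1r.
  rewrite xi1E -c2b.
  by field; rewrite !gt_eqF.
pose w tau := deviatile X tau / (beta * quantile X tau) - 1.
pose e tau := eta (1 - tau)^-1.
have e0 : e tau @[tau --> 1^'-] --> 0 by exact: (cvg_comp _ _ cvg_inv_onem eta0).
have etasg0 : eta t * Num.sg (A t) @[t --> +oo] --> 0.
  have g0 : `|eta t| @[t --> +oo] --> 0 by rewrite -(normr0 R); exact: cvg_norm.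
  apply: cvg0_le g0 _; apply: nearW => t.
  by rewrite normrM ler_piMr// normr_sg; case: (_ != 0).
(* Since |A| = sg(A) A, the remainder eta (1/U + |A|) splits into eta / U and (eta sg(A)) A, one
   share for each coefficient. *)
pose e' tau := e tau * Num.sg (A (1 - tau)^-1).
have e'0 : e' tau @[tau --> 1^'-] --> 0.
  exact: (cvg_comp _ _ cvg_inv_onem etasg0).
exists w, (fun tau => if xi1 X gamma == 0 then e tau else e tau / xi1 X gamma),
  (fun tau => if xi2 gamma rho == 0 then e' tau else e' tau / xi2 gamma rho).
have qE tau : U (1 - tau)^-1 = quantile X tau.
  by rewrite /U /tail_quantile invrK subKr.
have q0 : \forall tau \near 1^'-, 0 < quantile X tau.
  have h : \forall tau \near 1^'-, 0 < U (1 - tau)^-1 := @cvg_inv_onem R _ Ugt0.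
  by apply: filterS h => tau; rewrite qE.
split.
- case: (eqVneq (xi1 X gamma) 0) => _; first exact: e0.
  rewrite -(mul0r (xi1 X gamma)^-1); apply: cvgM; [exact: e0|exact: cvg_cst].
- case: (eqVneq (xi2 gamma rho) 0) => _; first exact: e'0.
  rewrite -(mul0r (xi2 gamma rho)^-1); apply: cvgM; [exact: e'0|exact: cvg_cst].
- near=> tau; have qt : 0 < quantile X tau by near: tau.
  rewrite /w subrKC mulrC divfK// mulf_neq0// gt_eqF//.
- near=> tau; have qt : 0 < quantile X tau by near: tau.
  rewrite !coef_1oE (mulrDl (xi1 X gamma)) (mulrDl (xi2 gamma rho)).
  have S0 : 0 < (quantile X tau)^-1 + `|A (1 - tau)^-1|.
    by rewrite ltr_wpDr// invr_gt0.
  have eE : e tau * ((quantile X tau)^-1 + `|A (1 - tau)^-1|) = w tau -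
      (xi1 X gamma * (quantile X tau)^-1 + xi2 gamma rho * A (1 - tau)^-1).
    by rewrite /e /eta qE invrK subKr divfK// gt_eqF.
  by move: eE; rewrite /e' -[e tau * _ * _]mulrA -normrEsg mulrDr; lra.
Unshelve. all: by end_near. Qed.
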